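(* Let $(X,\mathcal R)$ and $(Y,\mathcal S)$ be exactly triply regular symmetric $d$-class association schemes having the same Delta–Wye parameters with respect to orderings $A_0,\dots,A_d$, $A'_0,\dots,A'_d$ of their adjacency matrices and $E_0,\dots,E_d$, $E'_0,\dots,E'_d$ of their primitive idempotents, and let $\kappa:\mathbb A\to\mathbb A'$ be the linear map with $\kappa(A_i)=A'_i$ for $0\le i\le d$. Let $F$ be a connected planar graph, possibly with loops and multiple edges, and let $w:E(F)\to\mathbb A$ be any function. Then $$\mathsf S(F,\emptyset;w)=\mathsf S(F,\emptyset;\kappa\circ w).$$
   Context: A symmetric $d$-class association scheme $(X,\mathcal R)$ consists of a finite nonempty set $X$ and a partition $\mathcal R=\{R_0,\dots,R_d\}$ of $X\times X$ into nonempty symmetric relations, with $R_0=\{(x,x):x\in X\}$, such that for all $i,j,k$ the number $p_{ij}^k=|\{z\in X:(x,z)\in R_i,(z,y)\in R_j\}|$ (the intersection numbers) does not depend on the choice of $(x,y)\in R_k$. The adjacency matrix $A_i\in\mathrm{Mat}_X(\mathbb C)$ is the $0/1$ matrix of $R_i$. The Bose–Mesner algebra $\mathbb A=\mathrm{span}\{A_0,\dots,A_d\}$ is commutative and closed under ordinary matrix product and under the entrywise (Schur) product $\circ$; it has a second basis of primitive idempotents $E_0,\dots,E_d$ (symmetric, $E_iE_j=\delta_{ij}E_i$, $\sum_j E_j=I$). Eigenvalues $P_{ji}$ and dual eigenvalues $Q_{ji}$ are defined by $A_i=\sum_j P_{ji}E_j$ and $E_i=|X|^{-1}\sum_j Q_{ji}A_j$,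 and Krein parameters $q_{ij}^k$ by $E_i\circ E_j=|X|^{-1}\sum_k q_{ij}^kE_k$. For $L,M,N\in\mathrm{Mat}_X(\mathbb C)$ define tensors in $(\mathbb C^X)^{\otimes 3}$ (with standard basis vectors $\hat x$, $x\in X$): $\Delta(L,M,N)=\sum_{x,y,z\in X}L_{xz}M_{xy}N_{yz}\,\hat x\otimes\hat y\otimes\hat z$ and $\Upsilon(L,M,N)=\sum_{x,y,z,u\in X}L_{xu}M_{yu}N_{zu}\,\hat x\otimes\hat y\otimes\hat z$. Let $\Delta(\mathbb A)$ and $\Upsilon(\mathbb A)$ be the spans of all $\Delta(L,M,N)$, resp. $\Upsilon(L,M,N)$, with $L,M,N\in\mathbb A$. The scheme is triply regular if $\Upsilon(\mathbb A)\subseteq\Delta(\mathbb A)$, dually triply regular if $\Delta(\mathbb A)\subseteq\Upsilon(\mathbb A)$, and exactly triply regular if both hold. It is known that the tensors $\Upsilon(E_r,E_s,E_t)$ with $q_{rs}^t>0$ form a basis of $\Upsilon(\mathbb A)$. Delta–Wye parameters: if the scheme is exactly triply regular, then for each $i,j,k\in\{0,\dots,d\}$ there are unique scalars $\sigma^{i,j,k}_{r,s,t}$ ($r,s,t$ with $q_{rs}^t>0$; set $\sigma^{i,j,k}_{r,s,t}=0$ when $q_{rs}^t=0$) such that $\Delta(A_i,A_j,A_k)=\sum_{q_{rs}^t>0}\sigma^{i,j,k}_{r,s,t}\,\Upsilon(E_r,E_s,E_t)$. Two exactly triply regular $d$-class schemes $(X,\mathcal R)$, $(Y,\mathcal S)$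 have the same Delta–Wye parameters if there are orderings $A_0,\dots,A_d$ and $A'_0,\dots,A'_d$ of their adjacency matrices and $E_0,\dots,E_d$ and $E'_0,\dots,E'_d$ of their primitive idempotents such that $\sigma^{i,j,k}_{r,s,t}$ computed in $(X,\mathcal R)$ equals the corresponding $\sigma^{i,j,k}_{r,s,t}$ computed in $(Y,\mathcal S)$ for all $i,j,k,r,s,t\in\{0,\dots,d\}$. $\mathbb A'$ denotes the Bose–Mesner algebra of $(Y,\mathcal S)$. Scaffold of order zero: for a finite graph $F$ (loops and multiple edges allowed) and $w:E(F)\to\mathrm{Mat}_X(\mathbb C)$ with symmetric values, $\mathsf S(F,\emptyset;w)=\sum_{\varphi:V(F)\to X}\prod_{e\in E(F)}w(e)_{\varphi(a_e),\varphi(b_e)}$, where $a_e,b_e$ are the ends of $e$ ($a_e=b_e$ for a loop). *)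

(* Defs.v *)
From HB Require Import structures.
From mathcomp Require Import all_boot all_order all_algebra.
From mathcomp Require Import complex.
From mathcomp Require Import reals Rstruct.
From Stdlib Require Import Reals.

Set Implicit Arguments.
Unset Strict Implicit.
Unset Printing Implicit Defensive.

Import Order.TTheory GRing.Theory Num.Theory.

Notation Cplx := (Rdefinitions.R[i]).

Local Open Scope ring_scope.

Section Schemes.
Variables (C : numClosedFieldType) (n d : nat).

(* A symmetric d-class association scheme on X = 'I_n is given by the map
   rel : X -> X -> 'I_d.+1 sending (x,y) to the index i with (x,y) \in R_i;
   thus {R_0,...,R_d} is automatically a partition of X x X, and the
   ordering R_0,...,R_d (hence A_0,...,A_d) is the one given by the indices. *)
Definition is_sym_assoc_scheme (rel : 'I_n -> 'I_n -> 'I_d.+1) : Prop :=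
  [/\ (0 < n)%nat,
      (forall x y, (rel x y == ord0) = (x == y)),
      (forall x y, rel x y = rel y x),
      (forall i, exists x y, rel x y = i) &
      (forall i j k x y x' y', rel x y = k -> rel x' y' = k ->
          #|[set z | (rel x z == i) && (rel z y == j)]|
        = #|[set z | (rel x' z == i) && (rel z y' == j)]|)].

Definition adjmx (rel : 'I_n -> 'I_n -> 'I_d.+1) (i : 'I_d.+1) : 'M[C]_n :=
  \matrix_(x, y) (rel x y == i)%:R.

Definition inBM (rel : 'I_n -> 'I_n -> 'I_d.+1) (M : 'M[C]_n) : Prop :=
  exists c : 'I_d.+1 -> C, M = \sum_i c i *: adjmx rel i.

Definition is_prim_idempotents (rel : 'I_n -> 'I_n -> 'I_d.+1)
    (E : 'I_d.+1 -> 'M[C]_n) : Prop :=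
  [/\ (forall i, inBM rel (E i)),
      (forall i, (E i)^T = E i),
      (forall i j, E i *m E j = if i == j then E i else 0),
      \sum_i E i = 1%:M &
      (forall M, inBM rel M -> exists c : 'I_d.+1 -> C, M = \sum_i c i *: E i)].

Definition schur (M N : 'M[C]_n) : 'M[C]_n := \matrix_(x, y) (M x y * N x y).

Definition krein_pos (E : 'I_d.+1 -> 'M[C]_n) (r s t : 'I_d.+1) : Prop :=
  exists q : 'I_d.+1 -> C,
    schur (E r) (E s) = n%:R^-1 *: \sum_k q k *: E k /\ 0 < q t.

(* tensors in (C^X)^{(x)3}, as coefficient functions *)
Definition tensor := 'I_n -> 'I_n -> 'I_n -> C.

Definition Delta (L M N : 'M[C]_n) : tensor :=
  fun x y z => L x z * M x y * N y z.

Definition Ups (L M N : 'M[C]_n) : tensor :=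
  fun x y z => \sum_u L x u * M y u * N z u.

Definition in_span_of (op : 'M[C]_n -> 'M[C]_n -> 'M[C]_n -> tensor)
    (rel : 'I_n -> 'I_n -> 'I_d.+1) (t : tensor) : Prop :=
  exists s : seq (C * ('M[C]_n * 'M[C]_n * 'M[C]_n)),
    (forall p, p \in s -> [/\ inBM rel p.2.1.1, inBM rel p.2.1.2 & inBM rel p.2.2])
    /\ forall x y z,
         t x y z = \sum_(p <- s) p.1 * op p.2.1.1 p.2.1.2 p.2.2 x y z.

Definition exactly_triply_regular (rel : 'I_n -> 'I_n -> 'I_d.+1) : Prop :=
  (forall t, in_span_of Ups rel t -> in_span_of Delta rel t) /\
  (forall t, in_span_of Delta rel t -> in_span_of Ups rel t).

Definition is_DeltaWye (rel : 'I_n -> 'I_n -> 'I_d.+1) (E : 'I_d.+1 -> 'M[C]_n)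
    (sigma : 'I_d.+1 -> 'I_d.+1 -> 'I_d.+1 -> 'I_d.+1 -> 'I_d.+1 -> 'I_d.+1 -> C)
    : Prop :=
  forall i j k,
    (forall r s t, ~ krein_pos E r s t -> sigma i j k r s t = 0) /\
    forall x y z,
      Delta (adjmx rel i) (adjmx rel j) (adjmx rel k) x y z
      = \sum_r \sum_s \sum_t sigma i j k r s t * Ups (E r) (E s) (E t) x y z.

End Schemes.

(* ---------- Finite graphs with loops and multiple edges ----------
   A graph F is given by a finite vertex type V, a finite edge type Ed and
   ends : Ed -> V * V giving the ends (a_e, b_e) of each edge (a_e = b_e for
   a loop). *)
Section Graphs.
Variables (V Ed : finType) (ends : Ed -> V * V).

Definition gadj : rel V :=
  fun u v => [exists e, (ends e == (u, v)) || (ends e == (v, u))].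

Definition connected_graph : Prop :=
  (0 < #|V|)%nat /\ forall u v, connect gadj u v.

(* Planarity: existence of a drawing in R^2.  Vertices go to distinct
   points; each edge e is a continuous curve gamma_e : [0,1] -> R^2 from
   a_e to b_e, injective except that a loop closes up (gamma_e 0 = gamma_e 1);
   edge interiors avoid all vertex points and are pairwise disjoint. *)
Local Open Scope R_scope.

Definition unitI (t : R) : Prop := 0 <= t <= 1.
Definition openI (t : R) : Prop := 0 < t < 1.

Definition planar_graph : Prop :=
  exists (px py : V -> R) (gx gy : Ed -> R -> R),
    (forall u v, px u = px v -> py u = py v -> u = v) /\
    (forall e t, unitI t -> continue_in (gx e) unitI t /\ continue_in (gy e) unitI t) /\
    (forall e, gx e 0 = px (ends e).1 /\ gy e 0 = py (ends e).1 /\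
               gx e 1 = px (ends e).2 /\ gy e 1 = py (ends e).2) /\
    (forall e s t, unitI s -> unitI t -> s < t ->
        gx e s = gx e t -> gy e s = gy e t ->
        s = 0 /\ t = 1 /\ (ends e).1 = (ends e).2) /\
    (forall e t v, openI t -> ~ (gx e t = px v /\ gy e t = py v)) /\
    (forall e e' s t, e <> e' -> openI s -> openI t ->
        ~ (gx e s = gx e' t /\ gy e s = gy e' t)).

End Graphs.

Local Open Scope ring_scope.

Definition scaffold0 (C : numClosedFieldType) (n : nat) (V Ed : finType)
    (ends : Ed -> V * V) (w : Ed -> 'M[C]_n) : C :=
  \sum_(phi : {ffun V -> 'I_n}) \prod_(e : Ed) w e (phi (ends e).1) (phi (ends e).2).

(* Main.v *)
From Stdlib Require Import Reals Lra.
From Coquelicot Require Compactness.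
Require Import Defs.
From mathcomp Require Import all_boot all_order all_algebra.
From mathcomp Require Import ring zify.
From mathcomp Require boolp.
From mathcomp Require Import complex.
From mathcomp Require Import reals Rstruct.

(** Let b_j(M) act by the matrix M on the j-th tensor factor of (C^X)^{(x)k} and let
    a_j(M) multiply by M(x_j, x_(j+1)), for M in the Bose-Mesner algebra.  The spaces
    G_(2j) = {b_j(M)} and G_(2j+1) = {a_j(M)} are algebras, distant ones commute, and
    exact triple regularity says that G_i G_(i+1) G_i and G_(i+1) G_i G_(i+1) span the
    same space, so the algebra they generate behaves like a Hecke algebra: every element
    is a sum of words in which the last generator occurs at most once.  Moreover the
    trace is Markov: tr (g x) is a multiple of tr x when g lies in G_m and x in the
    algebra of the previous generators, because M has constant diagonal and constant
    row sums.  All the constants involved are functions of the Delta-Wye parameters, so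
    the traces of corresponding words agree for the two schemes.  Scaffolds of square
    grids are such traces.  Finally, pixelating a drawing exhibits every planar graph as
    a minor of a grid, and in a scaffold contraction and deletion of an edge amount to
    giving it weight I and J, both in the Bose-Mesner algebra. *)

Set Implicit Arguments.
Unset Strict Implicit.
Unset Printing Implicit Defensive.

Import Order.TTheory GRing.Theory Num.Theory.

Local Open Scope ring_scope.

(** * Markov traces on braid-like algebras *)

Section AdditiveSpan.
Variable A : nmodType.
Implicit Types (S T : A -> Prop) (x y : A).

Inductive add_span S : A -> Prop :=
| add_span0 : add_span S 0
| add_span_cons x y : S x -> add_span S y -> add_span S (x + y).

Lemma add_span_in S x : S x -> add_span S x.
Proof. by move=> Sx; rewrite -[x]addr0; apply: add_span_cons => //; exact: add_span0. Qed.

Lemma add_spanD S x y : add_span S x -> add_span S y -> add_span S (x + y).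
Proof.
move=> Sx Sy; elim: Sx => [|u v Su _ IH]; first by rewrite add0r.
by rewrite -addrA; apply: add_span_cons.
Qed.

Lemma add_span_sum S (J : finType) (F : J -> A) :
  (forall j, add_span S (F j)) -> add_span S (\sum_j F j).
Proof. by move=> SF; apply: big_ind => //; [exact: add_span0 | exact: add_spanD]. Qed.

Lemma add_span_bind S T x :
  (forall y, S y -> add_span T y) -> add_span S x -> add_span T x.
Proof.
move=> ST; elim=> [|u v Su _ IH]; first exact: add_span0.
by apply: add_spanD => //; exact: ST.
Qed.

End AdditiveSpan.

Section Sandwich.
Variable A : pzRingType.
Implicit Types (S T U : A -> Prop) (x y u v : A).

Lemma add_spanM S T U x y :
  (forall u v, S u -> T v -> add_span U (u * v)) ->
  add_span S x -> add_span T y -> add_span U (x * y).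
Proof.
move=> STU Sx Ty; elim: Sx => [|u x' Su _ IHx]; first by rewrite mul0r; exact: add_span0.
rewrite mulrDl; apply: add_spanD IHx.
elim: Ty => [|v y' Tv _ IHy]; first by rewrite mulr0; exact: add_span0.
by rewrite mulrDr; apply: add_spanD IHy; exact: STU.
Qed.

Definition sandwich S T : A -> Prop :=
  add_span (fun x => exists u g v, [/\ S u, T g, S v & x = u * g * v]).

Lemma sandwich_in S T u g v : S u -> T g -> S v -> sandwich S T (u * g * v).
Proof. by move=> Su Tg Sv; apply: add_span_in; exists u, g, v. Qed.

Lemma sandwichS S S' T x :
  (forall u, S u -> S' u) -> sandwich S T x -> sandwich S' T x.
Proof.
move=> SS'; apply: add_span_bind => _ [u [g [v [/SS' Su Tg /SS' Sv ->]]]].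
exact: sandwich_in.
Qed.

Lemma sandwich_mul S T u x v :
  (forall a b, S a -> S b -> S (a * b)) -> S u -> S v ->
  sandwich S T x -> sandwich S T (u * x * v).
Proof.
move=> SM Su Sv; elim=> [|_ x' [a [g [b [Sa Tg Sb ->]]]] _ IH].
  by rewrite mulr0 mul0r; exact: add_span0.
rewrite mulrDr mulrDl; apply: add_spanD => //.
by rewrite !mulrA -(mulrA _ b v); apply: sandwich_in => //; exact: SM.
Qed.

Inductive generated S : A -> Prop :=
| generated1 : generated S 1
| generated_in x : S x -> generated S x
| generatedD x y : generated S x -> generated S y -> generated S (x + y)
| generatedM x y : generated S x -> generated S y -> generated S (x * y).

Lemma generated_sub S T x : (forall y, S y -> T y) -> generated S x -> generated T x.
Proof.
move=> ST; elim=> [|y /ST Ty|y z _ Ty _ Tz|y z _ Ty _ Tz].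
- exact: generated1.
- exact: generated_in.
- exact: generatedD.
- exact: generatedM.
Qed.

Lemma generated_comm S x z :
  (forall y, S y -> y * z = z * y) -> generated S x -> x * z = z * x.
Proof.
move=> Sz; elim=> [|y /Sz //|y y' _ yz _ y'z|y y' _ yz _ y'z].
- by rewrite mul1r mulr1.
- by rewrite mulrDl mulrDr yz y'z.
- by rewrite -mulrA y'z !mulrA yz.
Qed.

End Sandwich.

Section BraidLikeAlgebra.
Variables (A : pzRingType) (G : nat -> A -> Prop) (M : nat).
Hypothesis G1 : forall i, (i < M)%N -> G i 1.
Hypothesis GM : forall i x y, (i < M)%N -> G i x -> G i y -> G i (x * y).
Hypothesis G_comm : forall i j x y, (i.+1 < j)%N -> (j < M)%N ->
  G i x -> G j y -> x * y = y * x.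
Hypothesis G_braid : forall i x y z, (i.+1 < M)%N ->
  G i.+1 x -> G i y -> G i.+1 z -> sandwich (G i) (G i.+1) (x * y * z).

Definition below m : A -> Prop := generated (fun x => exists2 i, (i < m)%N & G i x).

Lemma below_gen m i x : (i < m)%N -> G i x -> below m x.
Proof. by move=> im Gx; apply: generated_in; exists i. Qed.

Lemma below_leq m m' x : (m <= m')%N -> below m x -> below m' x.
Proof.
by move=> mm'; apply: generated_sub => y [i im Gy]; exists i; rewrite ?(leq_trans im).
Qed.

Lemma below_comm m g x : (m.+1 < M)%N -> G m.+1 g -> below m x -> x * g = g * x.
Proof. by move=> mM Gg; apply: generated_comm => y [i im Gy]; exact: G_comm Gy Gg. Qed.

Lemma sandwich_of_collapse m : (m < M)%N ->
  (forall g x g', G m g -> below m x -> G m g' -> sandwich (below m) (G m) (g * x * g')) ->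
  forall x, below m.+1 x -> sandwich (below m) (G m) x.
Proof.
move=> mM collapse x.
have mulB y z : below m y -> below m z -> below m (y * z) by exact: generatedM.
have B1 : below m 1 by exact: generated1.
elim=> [|{}x [i im Gx]|y z _ sy _ sz|y z _ sy _ sz].
- by rewrite -[1]mulr1 -[X in X * _]mul1r; apply: sandwich_in => //; exact: G1.
- move: im; rewrite ltnS leq_eqVlt => /predU1P[im|im].
    by rewrite im in Gx; rewrite -[x]mulr1 -[x]mul1r; apply: sandwich_in.
  by rewrite -[x]mulr1 -[x]mulr1; apply: sandwich_in; [exact: below_gen Gx | exact: G1 |].
- exact: add_spanD.
apply: add_spanM sy sz => _ _ [u [g [v [Bu Gg Bv ->]]]] [u' [g' [v' [Bu' Gg' Bv' ->]]]].
rewrite (_ : _ * _ = u * (g * (v * u') * g') * v'); last by rewrite !mulrA.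
by apply: sandwich_mul => //; apply: collapse => //; exact: mulB.
Qed.

(* The Hecke-algebra argument: inside G_m (below m) G_m the middle factor involves
   G_(m-1) only once, and everything around it commutes with G_m. *)
Lemma below_sandwich m : (m < M)%N ->
  forall x, below m.+1 x -> sandwich (below m) (G m) x.
Proof.
elim: m => [|m IHm] mM; apply: sandwich_of_collapse => // g x g' Gg Bx Gg'.
  have xg : x * g = g * x by apply: generated_comm Bx => y [].
  rewrite -xg -[_ * g']mulr1 -mulrA mulrA -(mulrA x).
  by apply: sandwich_in => //; [exact: GM | exact: generated1].
elim: (IHm (ltnW mM) x Bx) => [|_ y [p [h [q [Bp Gh Bq ->]]]] _ IHy].
  by rewrite mulr0 mul0r; exact: add_span0.
rewrite mulrDr mulrDl; apply: add_spanD IHy.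
have -> : g * (p * h * q) * g' = p * (g * h * g') * q.
  by rewrite !mulrA -(below_comm mM Gg Bp) -!mulrA (below_comm mM Gg' Bq).
apply: sandwich_mul.
- exact: generatedM.
- exact: below_leq Bp.
- exact: below_leq Bq.
- by apply: sandwichS (G_braid mM Gg Gh Gg') => z; exact: below_gen.
Qed.

Variables (C : pzRingType) (f : A -> C).
Hypothesis f0 : f 0 = 0.
Hypothesis fD : {morph f : x y / x + y}.
Hypothesis f_central : forall x y, f (x * y) = f (y * x).
Hypothesis f1 : f 1 = 0.
Hypothesis f_markov : forall m g x, (m < M)%N -> G m g -> below m x ->
  exists c, f (g * x) = c * f x.

Lemma markov_trace_eq0 x : below M x -> f x = 0.
Proof.
have: (M <= M)%N by []; elim: {1 3}M x => [|m IHm] x mM Bx.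
  rewrite -[x]mulr1; elim: Bx (1 : A) f1 => [|y []//|y z _ fy _ fz|y z _ fy _ fz] w fw.
  - by rewrite mul1r.
  - by rewrite mulrDl fD fy // fz // addr0.
  - by rewrite -mulrA fy // fz.
elim: (below_sandwich mM Bx) => [|_ y [u [g [v [Bu Gg Bv ->]]]] _ fy] //.
have Bvu : below m (v * u) by exact: generatedM.
rewrite fD fy addr0 -mulrA f_central -mulrA.
by have [c ->] := f_markov mM Gg Bvu; rewrite IHm ?mulr0 // ltnW.
Qed.

End BraidLikeAlgebra.

Lemma sum_pair (A B : nmodType) (J : finType) (f : J -> A) (g : J -> B) :
  (\sum_j f j, \sum_j g j) = \sum_j (f j, g j).
Proof. by apply: (big_rec3 (fun a b p => (a, b) = p)) => // j a b p _ <-. Qed.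

Section MarkovModels.
Variables (K : Type) (J : finType) (C : comPzRingType).

Record braid_constants := BraidConstants {
  unit_const : nat -> K;
  mul_const : nat -> K -> K -> K;
  braid_const : nat -> K -> K -> K -> J -> K * K * K;
  markov_const : nat -> K -> C
}.

Definition gens (A : Type) (g : nat -> K -> A) (i : nat) (x : A) : Prop :=
  exists c, x = g i c.

Record markov_model (M : nat) (D : braid_constants) (A : pzRingType)
    (g : nat -> K -> A) (tr : {additive A -> C}) : Prop := MarkovModel {
  model_unit : forall i, (i < M)%N -> g i (unit_const D i) = 1;
  model_mul : forall i a b, (i < M)%N -> g i a * g i b = g i (mul_const D i a b);
  model_comm : forall i j a b, (i.+1 < j)%N -> (j < M)%N -> g i a * g j b = g j b * g i a;
  model_braid : forall i a b c, (i.+1 < M)%N ->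
    g i.+1 a * g i b * g i.+1 c =
    \sum_q g i (braid_const D i a b c q).1.1 * g i.+1 (braid_const D i a b c q).1.2 *
            g i (braid_const D i a b c q).2;
  model_trC : forall x y, tr (x * y) = tr (y * x);
  model_markov : forall m c x, (m < M)%N -> below (gens g) m x ->
    tr (g m c * x) = markov_const D m c * tr x
}.

Variables (M : nat) (D : braid_constants).
Variables (A1 A2 : pzRingType) (g1 : nat -> K -> A1) (g2 : nat -> K -> A2).
Variables (tr1 : {additive A1 -> C}) (tr2 : {additive A2 -> C}).
Hypothesis model1 : markov_model M D g1 tr1.
Hypothesis model2 : markov_model M D g2 tr2.

Let g i c : A1 * A2 := (g1 i c, g2 i c).

Lemma below_pair m x : below (gens g) m x -> below (gens g1) m x.1 /\ below (gens g2) m x.2.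
Proof.
elim=> [|_ [i im [c ->]]|y z _ [y1 y2] _ [z1 z2]|y z _ [y1 y2] _ [z1 z2]].
- by split; exact: generated1.
- by split; apply: below_gen im _; exists c.
- by split; exact: generatedD.
- by split; exact: generatedM.
Qed.

Lemma pair_trace_eq x : tr1 1 = tr2 1 -> below (gens g) M x -> tr1 x.1 = tr2 x.2.
Proof.
move=> tr_1 Bx; apply/eqP; rewrite -subr_eq0; apply/eqP.
apply: (@markov_trace_eq0 _ (gens g) M _ _ _ _ C (fun y => tr1 y.1 - tr2 y.2)) Bx => /=.
- by move=> i iM; exists (unit_const D i); rewrite /g !(model_unit model1, model_unit model2).
- move=> i _ _ iM [a ->] [b ->]; exists (mul_const D i a b).
  by rewrite /g -(model_mul model1) // -(model_mul model2).
- move=> i j _ _ ij jM [a ->] [b ->].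
  by congr pair; [apply: (model_comm model1) | apply: (model_comm model2)].
- move=> i _ _ _ iM [a ->] [b ->] [c ->].
  have -> : g i.+1 a * g i b * g i.+1 c = (g1 i.+1 a * g1 i b * g1 i.+1 c,
                                            g2 i.+1 a * g2 i b * g2 i.+1 c) by [].
  rewrite (model_braid model1) // (model_braid model2) // sum_pair.
  apply: add_span_sum => q; set t := braid_const D i a b c q.
  by apply: (@sandwich_in _ _ _ (g i t.1.1) (g i.+1 t.1.2) (g i t.2)); eexists.
- by rewrite !raddf0 addr0.
- by move=> y z; rewrite !raddfD /=; ring.
- by move=> y z; rewrite (model_trC model1) (model_trC model2).
- by rewrite tr_1 subrr.
- move=> m _ y mM [c ->] /below_pair[y1 y2]; exists (markov_const D m c).
  by rewrite /= (model_markov model1) // (model_markov model2) // mulrBr.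
Qed.

Theorem markov_model_trace (s : seq (nat * K)) :
  tr1 1 = tr2 1 -> all (fun p => p.1 < M)%N s ->
  tr1 (\prod_(p <- s) g1 p.1 p.2) = tr2 (\prod_(p <- s) g2 p.1 p.2).
Proof.
move=> tr_1 sM.
suff: below (gens g) M (\prod_(p <- s) g1 p.1 p.2, \prod_(p <- s) g2 p.1 p.2).
  exact: pair_trace_eq.
elim: s sM => [|p s IH] /=; first by rewrite !big_nil => _; exact: generated1.
move=> /andP[pM /IH Bs]; rewrite !big_cons.
have -> : (g1 p.1 p.2 * \prod_(p <- s) g1 p.1 p.2, g2 p.1 p.2 * \prod_(p <- s) g2 p.1 p.2)
  = g p.1 p.2 * (\prod_(p <- s) g1 p.1 p.2, \prod_(p <- s) g2 p.1 p.2) by [].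
by apply: generatedM => //; apply: below_gen pM _; exists p.2.
Qed.

End MarkovModels.

(** * Bose-Mesner algebras *)

Lemma sum_mull_delta (R : pzSemiRingType) (I : finType) (i : I) (F : I -> R) :
  \sum_j (j == i)%:R * F j = F i.
Proof.
by rewrite (bigD1 i) //= eqxx mul1r big1 ?addr0 // => j /negbTE->; rewrite mul0r.
Qed.

Lemma sum_triple (R : nmodType) (I : finType) (F : I -> I -> I -> R) :
  \sum_i \sum_j \sum_k F i j k = \sum_(p : I * I * I) F p.1.1 p.1.2 p.2.
Proof. by rewrite !pair_bigA. Qed.

Lemma mul_sum3 (R : pzRingType) (I : finType) (F G H : I -> R) :
  (\sum_i F i) * (\sum_i G i) * (\sum_i H i) =
  \sum_(p : I * I * I) F p.1.1 * G p.1.2 * H p.2.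
Proof. by rewrite big_distrlr pair_bigA big_distrlr pair_bigA. Qed.

Lemma sum_mul_exchange (R : pzRingType) (I J : finType) (a : I -> R) (b : I -> J -> R)
    (F : J -> R) :
  \sum_i a i * (\sum_j b i j * F j) = \sum_j (\sum_i a i * b i j) * F j.
Proof.
under eq_bigr do rewrite mulr_sumr; rewrite exchange_big; apply: eq_bigr => j _.
by rewrite mulr_suml; apply: eq_bigr => i _; rewrite mulrA.
Qed.

Lemma mxtrace_idempotent (F : fieldType) (n : nat) (e : 'M[F]_n) :
  e *m e = e -> \tr e = (\rank e)%:R.
Proof.
move=> ee; have rc : row_base e *m col_base e = 1%:M.
  apply: (row_free_inj (row_base_free e)); apply: (row_full_inj (col_base_full e)).
  by rewrite mul1mx -mulmxA (mulmxA (col_base e)) !mulmx_base ee.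
by rewrite -{1}[e]mulmx_base mxtrace_mulC rc mxtrace1.
Qed.

Lemma mulmx_conj_tr_eq0 (C : numClosedFieldType) (m n : nat) (M : 'M[C]_(m, n)) :
  M *m (map_mx Num.conj M)^T = 0 -> M = 0.
Proof.
move=> MM0; apply/matrixP=> x y; move/matrixP/(_ x x)/eqP: MM0; rewrite !mxE.
rewrite (eq_bigr (fun z => `|M x z| ^+ 2)) => [|z _]; last by rewrite !mxE normCK.
rewrite psumr_eq0 => [/allP/(_ y (mem_index_enum _))/=|z _]; last exact: exprn_ge0.
by rewrite sqrf_eq0 normr_eq0 => /eqP.
Qed.

Lemma const_mx1_mulmx_const_mx1 (R : pzRingType) (n : nat) (M : 'M[R]_n) :
  const_mx 1 *m M *m const_mx 1 = const_mx (\sum_x \sum_y M x y) :> 'M_n.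
Proof.
apply/matrixP=> u v; rewrite !mxE exchange_big; apply: eq_bigr => y _ /=.
by rewrite !mxE mulr1; apply: eq_bigr => x _; rewrite mxE mul1r.
Qed.

Section LinearCoefficients.
Variables (C : comPzRingType) (d : nat).
Local Notation coef := ('I_d.+1 -> C).

Definition rebase (P : 'M[C]_d.+1) (c : coef) : coef := fun j => \sum_i c i * P i j.

Definition coef_triple (a b c : coef) (p : 'I_d.+1 * 'I_d.+1 * 'I_d.+1) : C :=
  a p.1.1 * b p.1.2 * c p.2.

Lemma sum_scale_sum (V : lmodType C) (P : 'M[C]_d.+1) (c : coef) (X Y : 'I_d.+1 -> V) :
  (forall i, X i = \sum_j P i j *: Y j) ->
  \sum_i c i *: X i = \sum_j rebase P c j *: Y j.
Proof.
move=> XE; under eq_bigr do rewrite XE scaler_sumr; rewrite exchange_big.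
apply: eq_bigr => j _; rewrite scaler_suml.
by apply: eq_bigr => i _; rewrite scalerA.
Qed.

End LinearCoefficients.

Section Tensors.
Variables (C : numClosedFieldType) (n d : nat).
Implicit Types (X : 'I_d.+1 -> 'M[C]_n) (a b c : 'I_d.+1 -> C).

Local Notation triple := ('I_d.+1 * 'I_d.+1 * 'I_d.+1)%type.

Definition Delta3 X (p : triple) : tensor C n := Delta (X p.1.1) (X p.1.2) (X p.2).
Definition Ups3 X (p : triple) : tensor C n := Ups (X p.1.1) (X p.1.2) (X p.2).

Lemma Delta_sum X a b c x y z :
  Delta (\sum_i a i *: X i) (\sum_i b i *: X i) (\sum_i c i *: X i) x y z =
  \sum_p coef_triple a b c p * Delta3 X p x y z.
Proof.
rewrite /Delta !summxE mul_sum3; apply: eq_bigr => p _.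
by rewrite !mxE /coef_triple /Delta3 /Delta; ring.
Qed.

Lemma Ups_sum X a b c x y z :
  Ups (\sum_i a i *: X i) (\sum_i b i *: X i) (\sum_i c i *: X i) x y z =
  \sum_p coef_triple a b c p * Ups3 X p x y z.
Proof.
rewrite /Ups3 /Ups; under [RHS]eq_bigr do rewrite mulr_sumr.
rewrite exchange_big; apply: eq_bigr => u _ /=.
rewrite !summxE mul_sum3; apply: eq_bigr => p _.
by rewrite !mxE /coef_triple; ring.
Qed.

Lemma Ups_inner (L M N L' M' N' : 'M[C]_n) :
  \sum_x \sum_y \sum_z Ups L M N x y z * Ups L' M' N' x y z =
  \sum_u \sum_v (L^T *m L') u v * (M^T *m M') u v * (N^T *m N') u v.
Proof.
rewrite sum_triple /Ups; under eq_bigr do rewrite big_distrlr /=.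
rewrite exchange_big; apply: eq_bigr => u _ /=.
rewrite exchange_big; apply: eq_bigr => v _ /=.
rewrite !mxE mul_sum3; apply: eq_bigr => p _.
by rewrite !mxE; ring.
Qed.

End Tensors.

Section BoseMesner.
Variables (C : numClosedFieldType) (n d : nat) (rel : 'I_n -> 'I_n -> 'I_d.+1).
Implicit Types c a b : 'I_d.+1 -> C.

Definition bmx c : 'M[C]_n := \sum_i c i *: adjmx C rel i.

Lemma bmxE c x y : bmx c x y = c (rel x y).
Proof.
rewrite /bmx summxE -[RHS](sum_mull_delta _ c); apply: eq_bigr => i _.
by rewrite !mxE mulrC eq_sym.
Qed.

Lemma eq_bmx a b : a =1 b -> bmx a = bmx b.
Proof. by move=> ab; apply/matrixP=> x y; rewrite !bmxE ab. Qed.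

Lemma schur_bmx a b : schur (bmx a) (bmx b) = bmx (fun i => a i * b i).
Proof. by apply/matrixP=> x y; rewrite !mxE !bmxE. Qed.

Lemma adjmx_bmx i : adjmx C rel i = bmx (fun j => (j == i)%:R).
Proof. by apply/matrixP=> x y; rewrite !mxE bmxE. Qed.

Lemma scale_bmx k c : k *: bmx c = bmx (fun i => k * c i).
Proof. by apply/matrixP=> x y; rewrite mxE !bmxE. Qed.

Lemma bmx_const1 : bmx (fun=> 1) = const_mx 1.
Proof. by apply/matrixP=> x y; rewrite !mxE bmxE. Qed.

Hypothesis rel_scheme : is_sym_assoc_scheme rel.

Lemma scheme_order_gt0 : (0 < n)%N. Proof. by case: rel_scheme. Qed.

Lemma scheme_order_neq0 : n%:R != 0 :> C.
Proof. by rewrite pnatr_eq0 -lt0n scheme_order_gt0. Qed.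

Lemma rel_eq0 x y : (rel x y == ord0) = (x == y).
Proof. by case: rel_scheme. Qed.

Lemma rel_diag x : rel x x = ord0.
Proof. by apply/eqP; rewrite rel_eq0. Qed.

Lemma bmx_diag c x : bmx c x x = c ord0.
Proof. by rewrite bmxE rel_diag. Qed.

Lemma bmx_id : bmx (fun i => (i == ord0)%:R) = 1%:M.
Proof. by apply/matrixP=> x y; rewrite bmxE !mxE rel_eq0. Qed.

Lemma tr_bmx c : (bmx c)^T = bmx c.
Proof. by case: rel_scheme => _ _ rs _ _; apply/matrixP=> x y; rewrite mxE !bmxE rs. Qed.

Lemma bmx_inj a b : bmx a = bmx b -> a =1 b.
Proof.
case: rel_scheme => _ _ _ rel_onto _ ab i; have [x [y <-]] := rel_onto i.
by move/matrixP/(_ x y): ab; rewrite !bmxE.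
Qed.

Variable E : 'I_d.+1 -> 'M[C]_n.
Hypothesis E_prim : is_prim_idempotents rel E.

Lemma prim_idempotent_bm r : exists c, E r = bmx c.
Proof. by case: E_prim => /(_ r). Qed.

Lemma tr_prim_idempotent r : (E r)^T = E r. Proof. by case: E_prim. Qed.

Lemma prim_idempotent_mul r s : E r *m E s = (r == s)%:R *: E r.
Proof. by case: E_prim => _ _ -> _ _; case: eqP => _; rewrite ?scale1r ?scale0r. Qed.

Lemma bmx_span_idempotents c : exists a, bmx c = \sum_r a r *: E r.
Proof. by case: E_prim => _ _ _ _; apply; exists c. Qed.

Lemma sum_idempotents_mull a s : (\sum_r a r *: E r) *m E s = a s *: E s.
Proof.
rewrite mulmx_suml (bigD1 s) //= -scalemxAl prim_idempotent_mul eqxx scale1r.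
rewrite big1 ?addr0 // => r /negbTE rs.
by rewrite -scalemxAl prim_idempotent_mul rs scale0r scaler0.
Qed.

Lemma sum_idempotents_mul a b :
  (\sum_r a r *: E r) *m (\sum_r b r *: E r) = \sum_r (a r * b r) *: E r.
Proof.
rewrite mulmx_sumr; apply: eq_bigr => r _.
by rewrite -scalemxAr sum_idempotents_mull scalerA mulrC.
Qed.

Lemma bmx_commute a b : bmx a *m bmx b = bmx b *m bmx a.
Proof.
have [[a' ->] [b' ->]] := (bmx_span_idempotents a, bmx_span_idempotents b).
by rewrite !sum_idempotents_mul; apply: eq_bigr => r _; rewrite mulrC.
Qed.

Definition eigenmatrix (P : 'M[C]_d.+1) : Prop :=
  forall i, adjmx C rel i = \sum_r P i r *: E r.

Lemma eigenmatrix_inv P : eigenmatrix P ->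
  P \in unitmx /\ forall r, E r = bmx (invmx P r).
Proof.
move=> PE; have [Q QE] := fin_all_exists prim_idempotent_bm.
have PQ : P *m (\matrix_(r, i) Q r i) = 1%:M.
  apply/matrixP=> i j; rewrite !mxE.
  have := PE i; rewrite (@sum_scale_sum _ _ _ (\matrix_(r, i) Q r i) _ E (adjmx C rel)).
    by rewrite adjmx_bmx => /bmx_inj/(_ j); rewrite eq_sym => ->.
  by move=> r; rewrite QE; apply: eq_bmx => k; rewrite mxE.
have [unitP _] := mulmx1_unit PQ; split=> // r; rewrite QE; apply: eq_bmx => i.
by rewrite -[invmx P]mulmx1 -PQ mulKmx // mxE.
Qed.

Lemma prim_idempotent_neq0 r : E r != 0.
Proof.
have /fin_all_exists[P PE] : forall i, exists p, adjmx C rel i = \sum_s p s *: E s.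
  by move=> i; rewrite adjmx_bmx; exact: bmx_span_idempotents.
have [|unitP invE] := @eigenmatrix_inv (\matrix_(i, s) P i s).
  by move=> i; rewrite PE; apply: eq_bigr => s _; rewrite mxE.
apply/eqP=> Er0; move/matrixP/(_ r r): (mulVmx unitP); rewrite !mxE eqxx big1 => [/esym/eqP|i _].
  by rewrite oner_eq0.
suff -> : invmx (\matrix_(i, s) P i s) r i = 0 by rewrite mul0r.
have bmx0 : bmx (fun=> 0) = 0 by apply/matrixP=> x y; rewrite bmxE mxE.
by apply: (@bmx_inj (invmx _ r) (fun=> 0)); rewrite -invE Er0 bmx0.
Qed.

Lemma scale_idempotent_inj r (a b : C) : a *: E r = b *: E r -> a = b.
Proof.
move/eqP; rewrite -subr_eq0 -scalerBl scaler_eq0 (negbTE (prim_idempotent_neq0 r)) orbF.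
by rewrite subr_eq0 => /eqP.
Qed.

Lemma mxtrace_prim_idempotent_gt0 r : 0 < \tr (E r).
Proof.
rewrite mxtrace_idempotent; last by rewrite prim_idempotent_mul eqxx scale1r.
by rewrite ltr0n lt0n mxrank_eq0 prim_idempotent_neq0.
Qed.

(* The conjugate F of E r lies in the algebra, so F *m E r = a *: E r with a idempotent;
   a = 0 would give E r *m (F)^T = 0, and a = 1 gives E r = F. *)
Lemma prim_idempotent_real r : map_mx Num.conj (E r) = E r.
Proof.
set F := map_mx _ _; have [c Ec] := prim_idempotent_bm r.
have FE : F = bmx (fun i => (c i)^*).
  by apply/matrixP=> x y; rewrite mxE Ec !bmxE.
have [a Fa] := bmx_span_idempotents (fun i => (c i)^*).
have comm : E r *m F = F *m E r by rewrite FE Ec bmx_commute.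
have FEa : F *m E r = a r *: E r by rewrite FE Fa sum_idempotents_mull.
have FF : F *m F = F by rewrite -map_mxM prim_idempotent_mul eqxx scale1r.
have a_idem : a r * a r = a r.
  by apply: (@scale_idempotent_inj r); rewrite -scalerA -!FEa scalemxAr -FEa mulmxA FF.
have a_neq0 : a r != 0.
  apply: contra (prim_idempotent_neq0 r) => /eqP a0; apply/eqP/mulmx_conj_tr_eq0.
  by rewrite map_trmx tr_prim_idempotent -/F comm FEa a0 scale0r.
have {a_idem}a1 : a r = 1 by apply: (mulIf a_neq0); rewrite mul1r.
have FEE : F *m E r = E r by rewrite FEa a1 scale1r.
rewrite -[RHS]FEE -[LHS]/F -comm; move/(congr1 (map_mx Num.conj)): FEE.
by rewrite map_mxM -map_mx_comp (eq_map_mx _ (@conjCK C)) map_mx_id -/F.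
Qed.

Definition trivial_idempotent (t : 'I_d.+1) : Prop := E t = n%:R^-1 *: const_mx 1.

Local Notation ones := (const_mx 1 : 'M[C]_n).

Lemma ones_mul_idempotent : exists t, ones *m E t = n%:R *: E t.
Proof.
have [a Ja] := bmx_span_idempotents (fun=> 1); rewrite bmx_const1 in Ja.
have JJ : ones *m ones = n%:R *: ones.
  apply/matrixP=> x y; rewrite !mxE (eq_bigr (fun=> 1)) => [|u _]; last by rewrite !mxE mulr1.
  by rewrite sumr_const card_ord mulr1.
have [t a_neq0] : exists t, a t != 0.
  apply/existsP; apply/existsPn => a0; have o := Ordinal scheme_order_gt0.
  have /matrixP/(_ o o)/eqP := Ja.
  rewrite big1 => [|r _]; last by rewrite (eqP (negPn (a0 r))) scale0r.
  by rewrite !mxE oner_eq0.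
exists t; rewrite Ja sum_idempotents_mull; congr (_ *: _); apply: (mulIf a_neq0).
apply: (@scale_idempotent_inj t).
have := congr1 (mulmx^~ (E t)) JJ; rewrite -mulmxA -scalemxAl Ja !sum_idempotents_mull.
by rewrite -scalemxAr sum_idempotents_mull !scalerA.
Qed.

Lemma trivial_idempotent_exists : exists t, trivial_idempotent t.
Proof.
have [t JE] := ones_mul_idempotent; exists t.
have n_neq0 := scheme_order_neq0.
have EJ : E t *m ones = n%:R *: E t.
  by apply: trmx_inj; rewrite trmx_mul linearZ /= tr_prim_idempotent -JE trmx_const.
have [s EsJ] : exists s, E t = s *: ones.
  exists (n%:R ^- 2 * \sum_x \sum_y E t x y).
  have := const_mx1_mulmx_const_mx1 (E t); rewrite JE -scalemxAl EJ scalerA -expr2.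
  move=> /(congr1 (GRing.scale (n%:R ^- 2))); rewrite scalerA mulVf ?expf_neq0 // scale1r => {1}->.
  by apply/matrixP=> x y; rewrite !mxE mulr1.
rewrite /trivial_idempotent EsJ; congr (_ *: _); apply: (mulIf n_neq0); rewrite mulVf //.
apply: (@scale_idempotent_inj t); rewrite scale1r.
have := prim_idempotent_mul t t.
by rewrite eqxx scale1r {1}EsJ -scalemxAl JE scalerA.
Qed.

Lemma bmx_rebase P c : eigenmatrix P ->
  bmx c = \sum_r rebase P c r *: E r.
Proof. exact: sum_scale_sum. Qed.

Lemma bmx_mul P a b : eigenmatrix P ->
  bmx a *m bmx b = bmx (rebase (invmx P) (fun r => rebase P a r * rebase P b r)).
Proof.
move=> PE; rewrite (bmx_rebase a PE) (bmx_rebase b PE) sum_idempotents_mul.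
by apply: sum_scale_sum => r; have [_ ->] := eigenmatrix_inv PE.
Qed.

Lemma bmx_rowsum P t c x : eigenmatrix P -> trivial_idempotent t ->
  \sum_y bmx c x y = rebase P c t.
Proof.
move=> PE Et; have := sum_idempotents_mull (rebase P c) t; rewrite -(bmx_rebase c PE) Et.
rewrite -scalemxAr => /matrixP/(_ x x); rewrite !mxE mulr1 mulrC.
move=> /(mulIf (invr_neq0 scheme_order_neq0)) <-.
by apply: eq_bigr => y _; rewrite mxE mulr1.
Qed.

Local Notation A := (adjmx C rel).
Local Notation triple := ('I_d.+1 * 'I_d.+1 * 'I_d.+1)%type.

Definition krein_trace (p : triple) : C :=
  \sum_u \sum_v E p.1.1 u v * E p.1.2 u v * E p.2 u v.

Lemma Ups3_orthogonal p q :
  \sum_x \sum_y \sum_z Ups3 E q x y z * Ups3 E p x y z = (q == p)%:R * krein_trace p.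
Proof.
have -> : (q == p) = (q.1.1 == p.1.1) && (q.1.2 == p.1.2) && (q.2 == p.2).
  by case: q p => [[? ?] ?] [[? ?] ?].
have mul_entry r s u v : ((E r)^T *m E s) u v = (r == s)%:R * E s u v.
  rewrite tr_prim_idempotent prim_idempotent_mul mxE.
  by case: eqP => [->|]; rewrite ?mul0r.
rewrite Ups_inner /krein_trace mulr_sumr; apply: eq_bigr => u _.
rewrite mulr_sumr; apply: eq_bigr => v _; rewrite !mul_entry -!mulnb !natrM.
by move: (_%:R) (_%:R) (_%:R) => a b c; ring.
Qed.

Lemma krein_traceE p k :
  schur (E p.1.1) (E p.1.2) = n%:R^-1 *: \sum_r k r *: E r ->
  krein_trace p = n%:R^-1 * k p.2 * \tr (E p.2).
Proof.
move=> kE; have := congr1 (fun M => \tr (M *m E p.2)) kE.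
rewrite -scalemxAl sum_idempotents_mull scalerA mxtraceZ => <-.
apply: eq_bigr => u _; rewrite mxE; apply: eq_bigr => v _.
by rewrite mxE; congr (_ * _); rewrite -{1}tr_prim_idempotent mxE.
Qed.

Lemma krein_pos_trace_neq0 p : krein_pos E p.1.1 p.1.2 p.2 -> krein_trace p != 0.
Proof.
move=> [k [kE k_gt0]]; rewrite (krein_traceE kE).
by rewrite !mulf_neq0 ?invr_eq0 ?scheme_order_neq0 // gt_eqF // mxtrace_prim_idempotent_gt0.
Qed.

Lemma krein_trace_gt0_pos p : 0 < krein_trace p -> krein_pos E p.1.1 p.1.2 p.2.
Proof.
have n_gt0 := scheme_order_gt0; have n_neq0 := scheme_order_neq0.
have [c Ec] := fin_all_exists prim_idempotent_bm.
have [k kE] := bmx_span_idempotents (fun i => c p.1.1 i * c p.1.2 i).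
have schurE : schur (E p.1.1) (E p.1.2) = n%:R^-1 *: \sum_r (n%:R * k r) *: E r.
  rewrite !Ec schur_bmx kE scaler_sumr; apply: eq_bigr => r _.
  by rewrite scalerA mulKf.
move=> kt_gt0; exists (fun r => n%:R * k r); split=> //; move: kt_gt0.
rewrite (krein_traceE schurE) pmulr_lgt0 ?mxtrace_prim_idempotent_gt0 //.
by rewrite pmulr_rgt0 // invr_gt0 ltr0n.
Qed.

Lemma Ups3_neq0_krein_pos p x y z : Ups3 E p x y z != 0 -> krein_pos E p.1.1 p.1.2 p.2.
Proof.
move=> U_neq0; apply: krein_trace_gt0_pos.
have U_real x' y' z' : (Ups3 E p x' y' z')^* = Ups3 E p x' y' z'.
  have E_real r u v : (E r u v)^* = E r u v by rewrite -{2}(prim_idempotent_real r) mxE.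
  by rewrite rmorph_sum /=; apply: eq_bigr => u _; rewrite !rmorphM /= !E_real.
have sq_ge0 x' y' z' : 0 <= Ups3 E p x' y' z' * Ups3 E p x' y' z'.
  by rewrite -{2}U_real -normCK exprn_ge0.
have := Ups3_orthogonal p p; rewrite eqxx mul1r sum_triple => <-.
rewrite lt_def sumr_ge0 // andbT psumr_eq0 //; apply: contra U_neq0.
by move=> /allP/(_ (x, y, z) (mem_index_enum _))/=; rewrite mulf_eq0 orbb.
Qed.

Lemma Ups3_coef_eq (a b : triple -> C) :
  (forall x y z, \sum_p a p * Ups3 E p x y z = \sum_p b p * Ups3 E p x y z) ->
  forall p, krein_pos E p.1.1 p.1.2 p.2 -> a p = b p.
Proof.
move=> ab p /krein_pos_trace_neq0 kt_neq0.
have coefE (c : triple -> C) :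
    \sum_x \sum_y \sum_z (\sum_q c q * Ups3 E q x y z) * Ups3 E p x y z = c p * krein_trace p.
  rewrite sum_triple; under eq_bigr do rewrite mulr_suml.
  rewrite exchange_big /= -(sum_mull_delta p (fun q => c q * krein_trace p)).
  apply: eq_bigr => q _; rewrite mulrCA -Ups3_orthogonal sum_triple mulr_sumr.
  by apply: eq_bigr => t _; rewrite mulrA.
apply: (mulIf kt_neq0); rewrite -!coefE.
by do 3!apply: eq_bigr => ? _; rewrite ab.
Qed.

Lemma sum_Ups_idempotent t r s t' x y : trivial_idempotent t ->
  \sum_z Ups (E r) (E s) (E t') x y z = ((t' == t) && (r == s))%:R * E r x y.
Proof.
move=> Et.
have colsum u : \sum_z E t' z u = (t' == t)%:R.
  have /matrixP/(_ u u) := prim_idempotent_mul t t'.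
  rewrite Et eq_sym -scalemxAl !mxE mulr1 mulrC => /(mulIf (invr_neq0 scheme_order_neq0)) <-.
  by apply: eq_bigr => z _; rewrite mxE mul1r.
rewrite exchange_big /= -mulnb natrM -mulrA.
have /matrixP/(_ x y) := prim_idempotent_mul r s; rewrite [in RHS]mxE => <-.
rewrite mxE mulr_sumr; apply: eq_bigr => u _.
rewrite -mulr_sumr colsum mulrC; congr (_ * (_ * _)).
by rewrite -{1}tr_prim_idempotent mxE.
Qed.

Lemma Ups3_trivial t x y z : trivial_idempotent t ->
  n%:R ^+ 2 * Ups3 E (t, t, t) x y z = 1.
Proof.
move=> Et; rewrite /Ups3 /Ups /= Et.
rewrite (eq_bigr (fun=> n%:R^-1 * n%:R^-1 * n%:R^-1)) => [|u _]; last by rewrite !mxE !mulr1.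
by rewrite sumr_const card_ord -[X in _ * X]mulr_natl; field; exact: scheme_order_neq0.
Qed.

Lemma sum_Delta3 x y z : \sum_p Delta3 A p x y z = 1.
Proof.
have := Delta_sum A (fun=> 1) (fun=> 1) (fun=> 1) x y z.
rewrite -/(bmx (fun=> 1)) bmx_const1 /Delta !mxE !mulr1 => ->.
by apply: eq_bigr => p _; rewrite /coef_triple !mul1r.
Qed.

Lemma sum_Delta3_diag i x y : \sum_z Delta3 A (i, i, ord0) x y z = A i x y.
Proof.
rewrite (bigD1 y) //= big1 => [|z zy]; rewrite /Delta3 /Delta /= !mxE rel_eq0.
  by rewrite eqxx mulr1 addr0 -natrM mulnb andbb.
by rewrite (eq_sym y) (negbTE zy) mulr0.
Qed.

Lemma in_span_Delta3 t : in_span_of (@Delta C n) rel t ->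
  exists T : triple -> C, forall x y z, t x y z = \sum_p T p * Delta3 A p x y z.
Proof.
move=> [s [s_bm tE]].
suff [T TE] : exists T : triple -> C, forall x y z,
    \sum_(p <- s) p.1 * Delta p.2.1.1 p.2.1.2 p.2.2 x y z = \sum_p T p * Delta3 A p x y z.
  by exists T => x y z; rewrite tE.
elim: s {tE} s_bm => [|[k [[L M] N]] s IH] s_bm.
  by exists (fun=> 0) => x y z; rewrite big_nil big1 // => p _; rewrite mul0r.
have [|T TE] := IH; first by move=> p ps; apply: s_bm; rewrite inE ps orbT.
have [/= [a ->] [b ->] [c ->]] := s_bm _ (mem_head _ _).
exists (fun p => k * coef_triple a b c p + T p) => x y z.
rewrite big_cons TE /= Delta_sum mulr_sumr -big_split /=.
by apply: eq_bigr => p _; rewrite mulrA mulrDl.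
Qed.

Lemma Ups3_in_Delta3 p : exactly_triply_regular C rel ->
  exists T : triple -> C, forall x y z, Ups3 E p x y z = \sum_q T q * Delta3 A q x y z.
Proof.
move=> [triply_regular _]; apply/in_span_Delta3/triply_regular.
exists [:: (1, (E p.1.1, E p.1.2, E p.2))]; split=> [q|x y z].
  by rewrite inE => /eqP ->; split; exact: prim_idempotent_bm.
by rewrite big_seq1 /= mul1r.
Qed.

End BoseMesner.

(** * Delta-Wye parameters *)

Section DeltaWyeCoefficients.
Variables (C : numClosedFieldType) (d : nat).
Local Notation triple := ('I_d.+1 * 'I_d.+1 * 'I_d.+1)%type.
Variable sigma : 'I_d.+1 -> 'I_d.+1 -> 'I_d.+1 -> 'I_d.+1 -> 'I_d.+1 -> 'I_d.+1 -> C.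

Definition sigma3 (p q : triple) : C := sigma p.1.1 p.1.2 p.2 q.1.1 q.1.2 q.2.

Definition dw_eigenmatrix (t : 'I_d.+1) : 'M[C]_d.+1 :=
  \matrix_(i, r) sigma i i ord0 r r t.

Definition sigma_linverse_row (p : triple) (T : triple -> C) : Prop :=
  forall q, \sum_p' T p' * sigma3 p' q = (q == p)%:R.

(* The rows that exist are those with q_rs^t > 0, whatever scheme sigma comes from. *)
Definition sigma_linverse (tau : triple -> triple -> C) : Prop :=
  forall p, sigma_linverse_row p (tau p) \/
    ~ (exists T, sigma_linverse_row p T) /\ (forall q, tau p q = 0).

Lemma sigma_linverse_exists : exists tau, sigma_linverse tau.
Proof.
suff /boolp.choice[tau tauP] : forall p, exists T, sigma_linverse_row p T \/
    ~ (exists T', sigma_linverse_row p T') /\ (forall q, T q = 0) by exists tau.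
move=> p; have [[T TP]|noT] := boolp.pselect (exists T, sigma_linverse_row p T).
  by exists T; left.
by exists (fun=> 0); right.
Qed.

End DeltaWyeCoefficients.

Section DeltaWye.
Variables (C : numClosedFieldType) (n d : nat) (rel : 'I_n -> 'I_n -> 'I_d.+1).
Hypothesis rel_scheme : is_sym_assoc_scheme rel.
Variable E : 'I_d.+1 -> 'M[C]_n.
Hypothesis E_prim : is_prim_idempotents rel E.
Variable sigma : 'I_d.+1 -> 'I_d.+1 -> 'I_d.+1 -> 'I_d.+1 -> 'I_d.+1 -> 'I_d.+1 -> C.
Hypothesis sigma_dw : is_DeltaWye rel E sigma.
Local Notation A := (adjmx C rel).
Local Notation triple := ('I_d.+1 * 'I_d.+1 * 'I_d.+1)%type.
Implicit Types (p q : triple) (a b c : 'I_d.+1 -> C).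

Lemma sigma3_eq0 p q : ~ krein_pos E q.1.1 q.1.2 q.2 -> sigma3 sigma p q = 0.
Proof. by have [sigma0 _] := sigma_dw p.1.1 p.1.2 p.2 => /sigma0. Qed.

Lemma Delta3_Ups3 p x y z : Delta3 A p x y z = \sum_q sigma3 sigma p q * Ups3 E q x y z.
Proof. by have [_ dwE] := sigma_dw p.1.1 p.1.2 p.2; rewrite [LHS]dwE sum_triple. Qed.

Lemma sum_sigma3 t q : trivial_idempotent E t ->
  \sum_p sigma3 sigma p q = (q == (t, t, t))%:R * n%:R ^+ 2.
Proof.
move=> Et.
have [kp|nkp] := boolp.pselect (krein_pos E q.1.1 q.1.2 q.2); last first.
  rewrite big1 => [|p _]; last exact: sigma3_eq0.
  case: eqP => [qt|]; last by rewrite mul0r.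
  case: nkp; pose x := Ordinal (scheme_order_gt0 rel_scheme).
  apply: (Ups3_neq0_krein_pos rel_scheme E_prim (x := x) (y := x) (z := x)); rewrite qt.
  have := Ups3_trivial rel_scheme x x x Et; apply: contra_eq_neq => ->.
  by rewrite mulr0 eq_sym oner_neq0.
move: q kp; apply: (Ups3_coef_eq rel_scheme E_prim) => x y z.
transitivity (1 : C).
  rewrite -(sum_Delta3 _ rel x y z); under eq_bigr do rewrite mulr_suml.
  by rewrite exchange_big; apply: eq_bigr => p _; rewrite Delta3_Ups3.
under eq_bigr do rewrite -mulrA.
by rewrite sum_mull_delta (Ups3_trivial rel_scheme).
Qed.

Lemma eigenmatrix_dw t : trivial_idempotent E t ->
  eigenmatrix rel E (dw_eigenmatrix sigma t).
Proof.
move=> Et i; apply/matrixP=> x y; rewrite -(sum_Delta3_diag _ rel_scheme) summxE.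
under eq_bigr do rewrite Delta3_Ups3.
rewrite exchange_big /=.
under eq_bigr do rewrite -mulr_sumr (sum_Ups_idempotent rel_scheme E_prim _ _ _ _ _ Et).
rewrite -(sum_triple (fun r s t' => sigma3 sigma (i, i, ord0) (r, s, t') *
  (((t' == t) && (r == s))%:R * E r x y))).
apply: eq_bigr => r _; rewrite !mxE.
rewrite -(sum_mull_delta r (fun s => sigma i i ord0 r s t * E r x y)).
apply: eq_bigr => s _.
rewrite -(sum_mull_delta t (fun t' => (s == r)%:R * (sigma i i ord0 r s t' * E r x y))).
by apply: eq_bigr => t' _; rewrite /sigma3 /= -mulnb natrM (eq_sym r); ring.
Qed.

Lemma krein_pos_sigma_linverse_row p (T : triple -> C) : krein_pos E p.1.1 p.1.2 p.2 ->
  (forall x y z, Ups3 E p x y z = \sum_q T q * Delta3 A q x y z) ->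
  sigma_linverse_row sigma p T.
Proof.
move=> kp TE q.
have [kq|nkq] := boolp.pselect (krein_pos E q.1.1 q.1.2 q.2); last first.
  rewrite big1 => [|p' _]; last by rewrite sigma3_eq0 ?mulr0.
  by case: eqP nkq => // -> /(_ kp).
move: q kq; apply: (Ups3_coef_eq rel_scheme E_prim) => x y z.
rewrite -sum_mul_exchange sum_mull_delta TE.
by apply: eq_bigr => q _; rewrite -Delta3_Ups3.
Qed.

Lemma sigma_linverse_row_Ups3 p (T : triple -> C) x y z : sigma_linverse_row sigma p T ->
  Ups3 E p x y z = \sum_q T q * Delta3 A q x y z.
Proof.
move=> TE; rewrite -[LHS](sum_mull_delta p (fun p => Ups3 E p x y z)).
under eq_bigr do rewrite -TE; rewrite -sum_mul_exchange.
by apply: eq_bigr => q _; rewrite -Delta3_Ups3.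
Qed.

Hypothesis rel_etr : exactly_triply_regular C rel.

Lemma Ups3_Delta3 tau p x y z : sigma_linverse sigma tau ->
  Ups3 E p x y z = \sum_q tau p q * Delta3 A q x y z.
Proof.
move=> /(_ p)[|[no_row tau0]]; first exact: sigma_linverse_row_Ups3.
rewrite big1 => [|q _]; last by rewrite tau0 mul0r.
apply/eqP; apply: boolp.contrapT => /negP /(Ups3_neq0_krein_pos rel_scheme E_prim) kp.
have [T TE] := Ups3_in_Delta3 E_prim p rel_etr.
by apply: no_row; exists T; exact: krein_pos_sigma_linverse_row.
Qed.

Definition wye_coef a b c q : C := \sum_p coef_triple a b c p * sigma3 sigma p q.

Lemma Delta_bmx a b c x y z :
  Delta (bmx rel a) (bmx rel b) (bmx rel c) x y z = \sum_q wye_coef a b c q * Ups3 E q x y z.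
Proof.
rewrite Delta_sum -sum_mul_exchange.
by apply: eq_bigr => p _; rewrite Delta3_Ups3.
Qed.

Definition delta_coef (P : 'M[C]_d.+1) (tau : triple -> triple -> C) a b c q : C :=
  \sum_p coef_triple (rebase P a) (rebase P b) (rebase P c) p * tau p q.

Lemma Ups_bmx P tau a b c x y z : eigenmatrix rel E P -> sigma_linverse sigma tau ->
  Ups (bmx rel a) (bmx rel b) (bmx rel c) x y z =
  \sum_q delta_coef P tau a b c q * Delta3 A q x y z.
Proof.
move=> PE tauE; rewrite !(bmx_rebase _ PE) Ups_sum -sum_mul_exchange.
by apply: eq_bigr => p _; rewrite (Ups3_Delta3 _ _ _ _ tauE).
Qed.

End DeltaWye.

(* The column sums of sigma determine both the trivial idempotent and the order. *)
Lemma same_trivial_idempotent (C : numClosedFieldType) (n m d : nat)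
    (rel1 : 'I_n -> 'I_n -> 'I_d.+1) (rel2 : 'I_m -> 'I_m -> 'I_d.+1)
    (E1 : 'I_d.+1 -> 'M[C]_n) (E2 : 'I_d.+1 -> 'M[C]_m) sigma :
  is_sym_assoc_scheme rel1 -> is_sym_assoc_scheme rel2 ->
  is_prim_idempotents rel1 E1 -> is_prim_idempotents rel2 E2 ->
  is_DeltaWye rel1 E1 sigma -> is_DeltaWye rel2 E2 sigma ->
  n = m /\ exists t, trivial_idempotent E1 t /\ trivial_idempotent E2 t.
Proof.
move=> scheme1 scheme2 prim1 prim2 dw1 dw2.
have [t1 Et1] := trivial_idempotent_exists scheme1 prim1.
have [t2 Et2] := trivial_idempotent_exists scheme2 prim2.
have := sum_sigma3 scheme1 prim1 dw1 (t1, t1, t1) Et1.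
rewrite (sum_sigma3 scheme2 prim2 dw2 (t1, t1, t1) Et2) eqxx mul1r.
case: eqP => [[t12 _ _]|_ /esym/eqP]; last first.
  by rewrite mul0r expf_eq0 /= (negbTE (scheme_order_neq0 C scheme1)).
rewrite mul1r => /eqP; rewrite -!natrX eqr_nat eqn_exp2r // => /eqP mn.
by split; [|exists t1; rewrite {2}t12].
Qed.

(** * Site and bond operators *)

Section KernelMatrices.
Variables (C : comPzRingType) (T : finType).
Implicit Types (K L : T -> T -> C) (f g : T -> C).

Definition kernel_mx K : 'M[C]_#|T| := \matrix_(i, j) K (enum_val i) (enum_val j).

Lemma eq_kernel_mx K L : K =2 L -> kernel_mx K = kernel_mx L.
Proof. by move=> KL; apply/matrixP=> i j; rewrite !mxE KL. Qed.

Lemma sum_enum_val (F : T -> C) : \sum_(i < #|T|) F (enum_val i) = \sum_t F t.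
Proof. by rewrite [RHS](reindex (enum_val : 'I_#|T| -> T)) //; exact/onW_bij/enum_val_bij. Qed.

Lemma kernel_mxM K L :
  kernel_mx K * kernel_mx L = kernel_mx (fun s t => \sum_u K s u * L u t).
Proof.
apply/matrixP=> i j; rewrite !mxE -sum_enum_val.
by apply: eq_bigr => u _; rewrite !mxE.
Qed.

Lemma kernel_mx_sum (J : finType) (K : J -> T -> T -> C) :
  kernel_mx (fun s t => \sum_j K j s t) = \sum_j kernel_mx (K j).
Proof. by apply/matrixP=> i j; rewrite summxE mxE; apply: eq_bigr => ? _; rewrite !mxE. Qed.

Lemma mxtrace_kernel_mx K : \tr (kernel_mx K) = \sum_t K t t.
Proof. by rewrite -sum_enum_val; apply: eq_bigr => i _; rewrite mxE. Qed.

Lemma kernel_mx1 : kernel_mx (fun s t => (s == t)%:R) = 1.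
Proof. by apply/matrixP=> i j; rewrite !mxE (inj_eq enum_val_inj). Qed.

Definition mult_mx f := kernel_mx (fun s t => (s == t)%:R * f s).

Lemma eq_mult_mx f g : f =1 g -> mult_mx f = mult_mx g.
Proof. by move=> fg; apply: eq_kernel_mx => s t; rewrite fg. Qed.

Lemma mult_mxMl f K : mult_mx f * kernel_mx K = kernel_mx (fun s t => f s * K s t).
Proof.
rewrite kernel_mxM; apply: eq_kernel_mx => s t.
rewrite -(sum_mull_delta s (fun u => f s * K u t)).
by apply: eq_bigr => u _; rewrite eq_sym mulrA.
Qed.

Lemma mult_mxMr K f : kernel_mx K * mult_mx f = kernel_mx (fun s t => K s t * f t).
Proof.
rewrite kernel_mxM; apply: eq_kernel_mx => s t.
rewrite -(sum_mull_delta t (fun u => K s u * f u)).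
by apply: eq_bigr => u _; ring.
Qed.

Lemma mult_mxM f g : mult_mx f * mult_mx g = mult_mx (fun s => f s * g s).
Proof. by rewrite mult_mxMl; apply: eq_kernel_mx => s t; ring. Qed.

Lemma mult_mx1 : mult_mx (fun=> 1) = 1.
Proof. by rewrite -kernel_mx1; apply: eq_kernel_mx => s t; rewrite mulr1. Qed.

End KernelMatrices.

Section SiteBondOperators.
Variables (C : comPzRingType) (n : nat) (I : finType).
Local Notation state := {ffun I -> 'I_n}.
Implicit Types (s t : state) (i j : I) (M N : 'M[C]_n).

Definition set_site s j x : state := [ffun i => if i == j then x else s i].

Definition eq_off j s t := set_site s j (t j) == t.

Lemma set_site_same s j x : set_site s j x j = x.
Proof. by rewrite ffunE eqxx. Qed.

Lemma set_site_other s j x i : i != j -> set_site s j x i = s i.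
Proof. by rewrite ffunE => /negbTE->. Qed.

Lemma set_site_id s j : set_site s j (s j) = s.
Proof. by apply/ffunP=> i; rewrite ffunE; case: eqP => [->|]. Qed.

Lemma set_site_twice s j x y : set_site (set_site s j x) j y = set_site s j y.
Proof. by apply/ffunP=> i; rewrite !ffunE; case: eqP. Qed.

Lemma set_siteC s i j x y : i != j ->
  set_site (set_site s i x) j y = set_site (set_site s j y) i x.
Proof.
move=> ij; apply/ffunP=> l; rewrite !ffunE; case: (eqVneq l j) => [->|//].
by rewrite eq_sym (negbTE ij).
Qed.

Lemma eq_off_set_site s j x t : eq_off j (set_site s j x) t = eq_off j s t.
Proof. by rewrite /eq_off set_site_twice. Qed.

Lemma sum_eq_off s j (F : state -> C) :
  \sum_u (eq_off j s u)%:R * F u = \sum_x F (set_site s j x).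
Proof.
transitivity (\sum_(u | eq_off j s u) F u).
  by rewrite [RHS]big_mkcond; apply: eq_bigr => u _; case: eq_off; rewrite ?mul1r ?mul0r.
rewrite (reindex_onto (set_site s j) (fun u => u j)) => [|u /eqP //].
by apply: eq_bigl => x; rewrite /eq_off !set_site_same !eqxx.
Qed.

Definition local_mx j (k : state -> 'I_n -> C) :=
  kernel_mx (fun s t => (eq_off j s t)%:R * k s (t j)).

Definition site_mx j M := local_mx j (fun s y => M (s j) y).

Definition bond_mx i j M := mult_mx (fun s : state => M (s i) (s j)).

Lemma eq_local_mx j k k' : k =2 k' -> local_mx j k = local_mx j k'.
Proof. by move=> kk'; apply: eq_kernel_mx => s t; rewrite kk'. Qed.

Lemma local_mxM j k k' : local_mx j k * local_mx j k' =
  local_mx j (fun s y => \sum_x k s x * k' (set_site s j x) y).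
Proof.
rewrite kernel_mxM; apply: eq_kernel_mx => s t.
under eq_bigr do rewrite -mulrA.
rewrite sum_eq_off mulr_sumr; apply: eq_bigr => x _.
by rewrite set_site_same eq_off_set_site; ring.
Qed.

Lemma mult_local_mx f j k : mult_mx f * local_mx j k = local_mx j (fun s y => f s * k s y).
Proof. by rewrite mult_mxMl; apply: eq_kernel_mx => s t; ring. Qed.

Lemma local_mult_mx f j k :
  local_mx j k * mult_mx f = local_mx j (fun s y => k s y * f (set_site s j y)).
Proof.
rewrite mult_mxMr; apply: eq_kernel_mx => s t; rewrite /eq_off.
by case: eqP => [->|_]; rewrite ?mul0r ?mulrA.
Qed.

Lemma local_mx_sum (J : finType) j (k : J -> state -> 'I_n -> C) :
  local_mx j (fun s y => \sum_p k p s y) = \sum_p local_mx j (k p).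
Proof. by rewrite -kernel_mx_sum; apply: eq_kernel_mx => s t; rewrite mulr_sumr. Qed.

Lemma mult_mx_local f j : mult_mx f = local_mx j (fun s y => (s j == y)%:R * f s).
Proof.
apply: eq_kernel_mx => s t; rewrite mulrA -natrM mulnb; congr ((nat_of_bool _)%:R * _).
apply/idP/andP => [/eqP->|[/eqP + /eqP st]]; first by rewrite /eq_off set_site_id !eqxx.
by rewrite -st set_site_id => ->.
Qed.

Lemma local_mx_scalar j a : local_mx j (fun s y => (s j == y)%:R * a) = a%:M.
Proof.
rewrite -(mult_mx_local (fun=> a)); apply/matrixP=> p q.
by rewrite !mxE (inj_eq enum_val_inj) mulr_natl.
Qed.

Lemma site_mxM j M N : site_mx j M * site_mx j N = site_mx j (M *m N).
Proof.
rewrite local_mxM; apply: eq_local_mx => s y; rewrite mxE.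
by apply: eq_bigr => x _; rewrite set_site_same.
Qed.

Lemma site_mx1 j : site_mx j 1%:M = 1.
Proof.
rewrite -mult_mx1 (mult_mx_local _ j); apply: eq_local_mx => s y.
by rewrite mxE mulr1.
Qed.

Lemma bond_mxM i j M N :
  bond_mx i j M * bond_mx i j N = bond_mx i j (\matrix_(x, y) (M x y * N x y)).
Proof. by rewrite mult_mxM; apply: eq_mult_mx => s; rewrite mxE. Qed.

Lemma bond_mx1 i j : bond_mx i j (const_mx 1) = 1.
Proof. by rewrite -mult_mx1; apply: eq_mult_mx => s; rewrite mxE. Qed.

Lemma bond_mx_tr i j M : bond_mx i j M^T = bond_mx j i M.
Proof. by apply: eq_mult_mx => s; rewrite mxE. Qed.

Lemma mult_mx_comm (f g : state -> C) : mult_mx f * mult_mx g = mult_mx g * mult_mx f.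
Proof. by rewrite !mult_mxM; apply: eq_mult_mx => s; rewrite mulrC. Qed.

Lemma site_mult_comm j M f : (forall s x, f (set_site s j x) = f s) ->
  site_mx j M * mult_mx f = mult_mx f * site_mx j M.
Proof.
by move=> fj; rewrite local_mult_mx mult_local_mx; apply: eq_local_mx => s y; rewrite fj mulrC.
Qed.

Lemma site_bond_comm j i i' M N : i != j -> i' != j ->
  site_mx j M * bond_mx i i' N = bond_mx i i' N * site_mx j M.
Proof. by move=> ij i'j; apply: site_mult_comm => s x; rewrite !set_site_other. Qed.

Lemma site_mxM_distinct i j M N : i != j -> site_mx i M * site_mx j N =
  kernel_mx (fun s t => (set_site (set_site s i (t i)) j (t j) == t)%:R *
                        (M (s i) (t i) * N (s j) (t j))).
Proof.
move=> ij; have ji : j != i by rewrite eq_sym.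
rewrite kernel_mxM; apply: eq_kernel_mx => s t.
under eq_bigr do rewrite -mulrA.
rewrite sum_eq_off -(sum_mull_delta (t i) (fun x =>
  (set_site (set_site s i x) j (t j) == t)%:R * (M (s i) x * N (s j) (t j)))).
apply: eq_bigr => x _; rewrite set_site_same (set_site_other _ _ ji) /eq_off.
case: (set_site _ _ _ =P t) => [st|]; rewrite ?mul0r ?mulr0 //.
have -> : x = t i by rewrite -st set_site_other // set_site_same.
by rewrite eqxx !mul1r.
Qed.

Lemma site_comm i j M N : i != j -> site_mx i M * site_mx j N = site_mx j N * site_mx i M.
Proof.
move=> ij; have ji : j != i by rewrite eq_sym.
rewrite !site_mxM_distinct //; apply: eq_kernel_mx => s t.
by rewrite set_siteC // [M _ _ * _]mulrC.
Qed.

Lemma prod_bond_mx (J : Type) (r : seq J) (a b : J -> I) (M : J -> 'M[C]_n) :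
  \prod_(l <- r) bond_mx (a l) (b l) (M l) =
  mult_mx (fun s => \prod_(l <- r) M l (s (a l)) (s (b l))).
Proof.
elim: r => [|l r IH]; first by rewrite big_nil -mult_mx1; apply: eq_mult_mx => s; rewrite big_nil.
by rewrite big_cons IH mult_mxM; apply: eq_mult_mx => s; rewrite big_cons.
Qed.

Lemma prod_site_mx_uniq (r : seq I) (M : I -> 'M[C]_n) : uniq r ->
  \prod_(i <- r) site_mx i (M i) =
  kernel_mx (fun s t => \prod_i (if i \in r then M i (s i) (t i) else (s i == t i)%:R)).
Proof.
elim: r => [_|j r IH /= /andP[jr ur]].
  rewrite big_nil -kernel_mx1; apply: eq_kernel_mx => s t.
  case: (eqVneq s t) => [->|st]; first by rewrite big1 // => i _; rewrite eqxx.
  have [i /negbTE sti] : exists i, s i != t i.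
    apply/existsP; apply: contraNT st => /existsPn st.
    by apply/eqP/ffunP=> i; apply/eqP/negPn/st.
  by rewrite (bigD1 i) //= sti mul0r.
rewrite big_cons IH // kernel_mxM; apply: eq_kernel_mx => s t.
under [LHS]eq_bigr do rewrite -mulrA.
rewrite sum_eq_off (bigD1 j) //= mem_head.
rewrite -(sum_mull_delta (t j) (fun x => M j (s j) x * _)); apply: eq_bigr => x _.
rewrite set_site_same mulrCA; congr (_ * _).
rewrite (bigD1 j) //= (negbTE jr) set_site_same; congr (_ * _).
by apply: eq_bigr => i ij; rewrite set_site_other // inE (negbTE ij).
Qed.

Lemma prod_site_mx (M : I -> 'M[C]_n) :
  \prod_i site_mx i (M i) = kernel_mx (fun s t => \prod_i M i (s i) (t i)).
Proof.
rewrite prod_site_mx_uniq ?index_enum_uniq //; apply: eq_kernel_mx => s t.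
by apply: eq_bigr => i _; rewrite mem_index_enum.
Qed.

End SiteBondOperators.

Lemma mxtrace_average (C : comPzRingType) (N : nat) (J : finType) (a : C)
    (u v : J -> 'M[C]_N) (g x : 'M[C]_N) :
  \sum_p u p * v p = a%:M -> (forall p, x * v p = v p * x) ->
  a * \tr (g * x) = \tr ((\sum_p v p * g * u p) * x).
Proof.
move=> uv comm; rewrite -mxtraceZ -mulmxE scalemxAr -mul_scalar_mx -uv !mulmxE.
rewrite !mulr_suml mulr_sumr !raddf_sum; apply: eq_bigr => p _ /=.
by rewrite -(mulrA (u p)) -comm !mulrA mxtrace_mulC mulmxE !mulrA.
Qed.

Section StarTriangle.
Variables (C : numClosedFieldType) (n : nat) (I : finType) (i j : I).
Hypothesis ij : i != j.
Local Notation state := {ffun I -> 'I_n}.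
Local Notation site_mx := (@site_mx C n I).
Local Notation bond_mx := (@bond_mx C n I).
Implicit Types (L M N : 'M[C]_n) (x : 'M[C]_#|state|).

Lemma site_bond_site L M N : N^T = N ->
  site_mx j L * bond_mx i j M * site_mx j N = local_mx j (fun s y => Ups L N M (s j) y (s i)).
Proof.
move=> Ns; rewrite local_mult_mx local_mxM; apply: eq_local_mx => s y.
apply: eq_bigr => x _; rewrite !set_site_same set_site_other // -{1}Ns mxE.
by ring.
Qed.

Lemma bond_site_bond L M N : L^T = L -> N^T = N ->
  bond_mx i j L * site_mx j M * bond_mx i j N = local_mx j (fun s y => Delta L M N (s j) y (s i)).
Proof.
move=> Ls Ns; rewrite mult_local_mx local_mult_mx; apply: eq_local_mx => s y; rewrite /Delta.
by rewrite !set_site_same set_site_other // -{1}Ls -{1}Ns !mxE.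
Qed.

Lemma mxtrace_site_mx (mu : C) M x :
  (forall a, M a a = mu) ->
  (forall f : 'I_n -> C, x * mult_mx (fun s : state => f (s j)) =
                         mult_mx (fun s : state => f (s j)) * x) ->
  \tr (site_mx j M * x) = mu * \tr x.
Proof.
move=> M_diag comm; pose D a := mult_mx (fun s : state => (s j == a)%:R : C).
rewrite -[LHS]mul1r (@mxtrace_average _ _ _ _ D D); first last.
- by move=> a; apply: (comm (fun y => (y == a)%:R)).
- under eq_bigr => a _ do rewrite mult_mxM (mult_mx_local _ j).
  rewrite -local_mx_sum -(local_mx_scalar n j 1); apply: eq_local_mx => s y.
  rewrite -mulr_sumr; congr (_ * _); rewrite -[RHS](sum_mull_delta (s j) (fun=> 1)).
  by apply: eq_bigr => a _; rewrite eq_sym mulr1 -natrM mulnb andbb.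
suff -> : \sum_a D a * site_mx j M * D a = mu%:M by rewrite -mulmxE mul_scalar_mx mxtraceZ.
under eq_bigr => a _ do rewrite mult_local_mx local_mult_mx.
rewrite -local_mx_sum -(local_mx_scalar n j mu); apply: eq_local_mx => s y.
transitivity (M (s j) y * (s j == y)%:R).
  rewrite -(sum_mull_delta (s j) (fun a => M (s j) y * (a == y)%:R)); apply: eq_bigr => a _.
  by rewrite set_site_same eq_sym [in RHS](eq_sym a y) mulrA.
by case: eqP => [<-|_]; rewrite ?M_diag ?mulr0 ?mul0r // mulrC.
Qed.

Lemma mxtrace_bond_mx (rho : C) M x :
  (forall a, \sum_b M a b = rho) ->
  (forall N, x * site_mx j N = site_mx j N * x) ->
  n%:R * \tr (bond_mx i j M * x) = rho * \tr x.
Proof.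
move=> M_row comm; pose e (p : 'I_n * 'I_n) : 'M[C]_n := delta_mx p.1 p.2.
rewrite (@mxtrace_average _ _ _ _ (fun p => site_mx j (e p)) (fun p => site_mx j (e (p.2, p.1)))).
- suff -> : \sum_p site_mx j (e (p.2, p.1)) * bond_mx i j M * site_mx j (e p) = rho%:M.
    by rewrite -mulmxE mul_scalar_mx mxtraceZ.
  under eq_bigr => p _ do rewrite local_mult_mx local_mxM.
  rewrite -local_mx_sum -(local_mx_scalar n j rho); apply: eq_local_mx => s y.
  rewrite -(pair_bigA _ (fun p q => \sum_x e (q, p) (s j) x * M _ _ * e (p, q) _ y)) /=.
  rewrite -(M_row (s i)) mulr_sumr; apply: eq_bigr => p _.
  transitivity (\sum_q (q == s j)%:R * (M (s i) p * (q == y)%:R)).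
    apply: eq_bigr => q _.
    rewrite -(sum_mull_delta p (fun z => (q == s j)%:R * (M (s i) z * (q == y)%:R))).
    apply: eq_bigr => z _; rewrite !set_site_same set_site_other // !mxE.
    rewrite (eq_sym (s j)) (eq_sym y).
    by case: (z == p); case: (q == s j); case: (q == y); rewrite /=; ring.
  by rewrite sum_mull_delta mulrC.
- under eq_bigr => p _ do rewrite site_mxM mul_delta_mx.
  rewrite -(pair_bigA _ (fun p q => site_mx j (delta_mx p p))) /=.
  under eq_bigr => p _ do rewrite sumr_const card_ord -scaler_nat.
  rewrite -scaler_sumr -local_mx_sum.
  have -> : local_mx j (fun s y => \sum_p (delta_mx p p : 'M[C]_n) (s j) y) = 1.
    rewrite -(site_mx1 _ n j); apply: eq_local_mx => s y.
    by rewrite scalar_mx_sum_delta summxE; apply: eq_bigr => p _; rewrite scale1r.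
  by apply/matrixP=> p q; rewrite !mxE mulr_natr.
- by move=> p; exact: comm.
Qed.

End StarTriangle.

(** * Transfer matrices of schemes with given Delta-Wye parameters *)

Section GridGenerators.
Variables (C : numClosedFieldType) (n k : nat).
Local Notation state := {ffun 'I_k.+1 -> 'I_n}.
Implicit Types (i j : nat) (M N : 'M[C]_n) (f : 'I_n -> C).

(* Sites and bonds of the chain 0 - 1 - ... - k alternate. *)
Definition grid_gen i M : 'M[C]_#|state| :=
  if odd i then bond_mx (inord i./2) (inord i./2.+1) M else site_mx (inord i./2) M.

Lemma inord_neq i j : (i <= k)%N -> (j <= k)%N -> i != j -> (inord i : 'I_k.+1) != inord j.
Proof. by move=> ik jk; rewrite -val_eqE /= !inordK. Qed.

Lemma grid_gen_comm i j M N : (i.+1 < j)%N -> (j < k.*2.+1)%N ->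
  grid_gen i M * grid_gen j N = grid_gen j N * grid_gen i M.
Proof.
move=> ij jk; rewrite /grid_gen; case: ifP => oi; case: ifP => oj.
- exact: mult_mx_comm.
- by rewrite site_bond_comm //; apply: inord_neq; lia.
- by rewrite -site_bond_comm //; apply: inord_neq; lia.
- by apply: site_comm; apply: inord_neq; lia.
Qed.

Lemma grid_gen_mult_comm i j M f : (i < j.*2)%N -> (j <= k)%N ->
  grid_gen i M * mult_mx (fun s : state => f (s (inord j))) =
  mult_mx (fun s : state => f (s (inord j))) * grid_gen i M.
Proof.
move=> ij jk; rewrite /grid_gen; case: ifP => oi; first exact: mult_mx_comm.
by rewrite site_mult_comm // => s x; rewrite set_site_other //; apply: inord_neq; lia.
Qed.

Lemma grid_gen_site_comm i j M N : (i < j.*2.+1)%N -> (j < k)%N ->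
  grid_gen i M * site_mx (inord j.+1) N = site_mx (inord j.+1) N * grid_gen i M.
Proof.
move=> ij jk; rewrite /grid_gen; case: ifP => oi.
  by rewrite site_bond_comm //; apply: inord_neq; lia.
by apply: site_comm; apply: inord_neq; lia.
Qed.

End GridGenerators.

Section GridConstants.
Variables (C : numClosedFieldType) (n d : nat).
Variable sigma : 'I_d.+1 -> 'I_d.+1 -> 'I_d.+1 -> 'I_d.+1 -> 'I_d.+1 -> 'I_d.+1 -> C.
Local Notation coef := ('I_d.+1 -> C).
Local Notation triple := ('I_d.+1 * 'I_d.+1 * 'I_d.+1)%type.
Variables (tau : triple -> triple -> C) (t : 'I_d.+1).
Local Notation P := (dw_eigenmatrix sigma t).
Implicit Types a b c : coef.

Definition grid_unit (i : nat) : coef :=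
  if odd i then fun=> 1 else fun l => (l == ord0)%:R.

Definition grid_mul (i : nat) a b : coef :=
  if odd i then fun l => a l * b l
  else rebase (invmx P) (fun r => rebase P a r * rebase P b r).

Definition site_bond_braid a b c (q : triple) : coef * coef * coef :=
  (fun l => delta_coef P tau a c b q * (l == q.1.1)%:R,
   fun l => (l == q.1.2)%:R, fun l => (l == q.2)%:R).

Definition bond_site_braid a b c (q : triple) : coef * coef * coef :=
  (fun l => wye_coef sigma a b c q * invmx P q.1.1 l, invmx P q.2, invmx P q.1.2).

Definition grid_braid (i : nat) a b c (q : triple) : coef * coef * coef :=
  if odd i then site_bond_braid a b c q else bond_site_braid a b c q.

Definition grid_markov (i : nat) c : C :=
  if odd i then n%:R^-1 * rebase P c t else c ord0.

Definition grid_constants : braid_constants coef triple C :=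
  BraidConstants grid_unit grid_mul grid_braid grid_markov.

Variables (k : nat) (rel : 'I_n -> 'I_n -> 'I_d.+1) (E : 'I_d.+1 -> 'M[C]_n).
Hypothesis rel_scheme : is_sym_assoc_scheme rel.
Hypothesis E_prim : is_prim_idempotents rel E.
Hypothesis rel_etr : exactly_triply_regular C rel.
Hypothesis sigma_dw : is_DeltaWye rel E sigma.
Hypothesis tau_linverse : sigma_linverse sigma tau.
Hypothesis Et : trivial_idempotent E t.

Local Notation state := {ffun 'I_k.+1 -> 'I_n}.

Definition scheme_gen (i : nat) c : 'M[C]_#|state| := grid_gen k i (bmx rel c).

Let PE : eigenmatrix rel E P. Proof. exact: (eigenmatrix_dw rel_scheme E_prim sigma_dw Et). Qed.

Lemma site_bond_site_expand (i j : 'I_k.+1) a b c : i != j ->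
  site_mx j (bmx rel a) * bond_mx i j (bmx rel b) * site_mx j (bmx rel c) =
  \sum_q bond_mx i j (bmx rel (site_bond_braid a b c q).1.1) *
          site_mx j (bmx rel (site_bond_braid a b c q).1.2) *
          bond_mx i j (bmx rel (site_bond_braid a b c q).2).
Proof.
move=> ij; rewrite site_bond_site ?tr_bmx //.
under [RHS]eq_bigr do rewrite bond_site_bond ?tr_bmx // -scale_bmx -!adjmx_bmx.
rewrite -local_mx_sum; apply: eq_local_mx => s y.
rewrite (Ups_bmx rel_scheme E_prim sigma_dw rel_etr _ _ _ _ _ _ PE tau_linverse).
by apply: eq_bigr => q _; rewrite /Delta mxE !mulrA.
Qed.

Lemma bond_site_bond_expand (i j : 'I_k.+1) a b c : i != j ->
  bond_mx i j (bmx rel a) * site_mx j (bmx rel b) * bond_mx i j (bmx rel c) =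
  \sum_q site_mx j (bmx rel (bond_site_braid a b c q).1.1) *
          bond_mx i j (bmx rel (bond_site_braid a b c q).1.2) *
          site_mx j (bmx rel (bond_site_braid a b c q).2).
Proof.
move=> ij; rewrite bond_site_bond ?tr_bmx //.
have [_ QE] := eigenmatrix_inv rel_scheme E_prim PE.
under [RHS]eq_bigr do rewrite site_bond_site ?tr_bmx // -scale_bmx -!QE.
rewrite -local_mx_sum; apply: eq_local_mx => s y; rewrite (Delta_bmx sigma_dw).
apply: eq_bigr => q _; rewrite /Ups3 /Ups mulr_sumr.
by apply: eq_bigr => u _; rewrite mxE !mulrA.
Qed.

Lemma scheme_gen_braid i a b c : (i.+1 < k.*2.+1)%N ->
  scheme_gen i.+1 a * scheme_gen i b * scheme_gen i.+1 c =
  \sum_q scheme_gen i (grid_braid i a b c q).1.1 *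
          scheme_gen i.+1 (grid_braid i a b c q).1.2 *
          scheme_gen i (grid_braid i a b c q).2.
Proof.
rewrite /scheme_gen /grid_gen /= => ik; case: (boolP (odd i)) => oi /=.
  have -> : uphalf i = i./2.+1 by lia.
  rewrite site_bond_site_expand; last by apply: inord_neq; lia.
  by apply: eq_bigr => q _; rewrite /grid_braid oi.
have -> : uphalf i = i./2 by lia.
rewrite -!(bond_mx_tr (inord i./2.+1)) !tr_bmx //.
rewrite bond_site_bond_expand; last by apply: inord_neq; lia.
apply: eq_bigr => q _; rewrite /grid_braid (negbTE oi) /=.
by rewrite -(bond_mx_tr (inord i./2.+1)) tr_bmx.
Qed.

Lemma scheme_gen_markov m c x : (m < k.*2.+1)%N -> below (gens scheme_gen) m x ->
  \tr (scheme_gen m c * x) = grid_markov m c * \tr x.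
Proof.
move=> mk Bx.
have below_commutes z : (forall i a, (i < m)%N -> scheme_gen i a * z = z * scheme_gen i a) ->
    x * z = z * x.
  by move=> gz; apply: generated_comm Bx => _ [i im [a ->]]; exact: gz.
rewrite /scheme_gen /grid_markov {1}/grid_gen; case: ifP => om.
  apply: (mulfI (scheme_order_neq0 C rel_scheme)).
  rewrite (@mxtrace_bond_mx _ _ _ _ _ _ (rebase P c t)).
  - by rewrite !mulrA mulfV ?mul1r // (scheme_order_neq0 C rel_scheme).
  - by apply: inord_neq; lia.
  - by move=> y; apply: (bmx_rowsum rel_scheme E_prim _ _ PE Et).
  - by move=> N; apply: below_commutes => i a im; apply: grid_gen_site_comm; lia.
apply: mxtrace_site_mx => [y|f]; first exact: bmx_diag.
by apply: below_commutes => i a im; apply: grid_gen_mult_comm; lia.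
Qed.

Theorem scheme_markov_model :
  markov_model k.*2.+1 grid_constants scheme_gen [the {additive _ -> C} of mxtrace].
Proof.
split=> /=.
- move=> i _; rewrite /scheme_gen /grid_gen /grid_unit; case: (odd i).
    by rewrite bmx_const1 bond_mx1.
  by rewrite bmx_id // site_mx1.
- move=> i a b _; rewrite /scheme_gen /grid_gen /grid_mul; case: (odd i).
    by rewrite bond_mxM -schur_bmx.
  by rewrite site_mxM (bmx_mul rel_scheme E_prim _ _ PE).
- by move=> i j a b ij jk; exact: grid_gen_comm.
- exact: scheme_gen_braid.
- exact: mxtrace_mulC.
- exact: scheme_gen_markov.
Qed.

End GridConstants.

(** * Scaffolds of grid graphs *)

Section ClosedWalks.
Variables (C : comPzRingType) (T : finType).

Definition ffun_rcons R (P : {ffun 'I_R -> T}) (u : T) : {ffun 'I_R.+1 -> T} :=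
  [ffun r => oapp P u (unlift ord_max r)].

Lemma ffun_rcons_lift R (P : {ffun 'I_R -> T}) u r : ffun_rcons P u (lift ord_max r) = P r.
Proof. by rewrite ffunE liftK. Qed.

Lemma ffun_rcons_max R (P : {ffun 'I_R -> T}) u : ffun_rcons P u ord_max = u.
Proof. by rewrite ffunE unlift_none. Qed.

Lemma sum_ffun_rcons R (F : {ffun 'I_R.+1 -> T} -> C) :
  \sum_P F P = \sum_P \sum_u F (ffun_rcons P u).
Proof.
rewrite pair_bigA (reindex (fun Pu : {ffun 'I_R -> T} * T => ffun_rcons Pu.1 Pu.2)) //=.
exists (fun P => ([ffun r => P (lift ord_max r)], P ord_max)) => [[P u] _|P _] /=.
  by congr pair; [apply/ffunP=> r; rewrite ffunE ffun_rcons_lift | exact: ffun_rcons_max].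
apply/ffunP=> r; case: (unliftP ord_max r) => [r' ->|->]; last by rewrite ffun_rcons_max.
by rewrite ffun_rcons_lift ffunE.
Qed.

Lemma widen_ord_lift_max R (r : 'I_R) : widen_ord (leqnSn R) r = lift ord_max r.
Proof. by apply: ord_inj; rewrite lift_max. Qed.

Lemma mxtrace_prod_kernel_mx R (K : 'I_R -> T -> T -> C) (L : T -> T -> C) :
  \tr ((\prod_(r < R) kernel_mx (K r)) * kernel_mx L) =
  \sum_(P : {ffun 'I_R.+1 -> T})
    (\prod_(r < R) K r (P (lift ord_max r)) (P (lift ord0 r))) * L (P ord_max) (P ord0).
Proof.
elim: R K L => [|R IH] K L.
  rewrite big_ord0 mul1r mxtrace_kernel_mx (reindex (fun s => [ffun=> s] : {ffun 'I_1 -> T})) /=.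
    by apply: eq_bigr => s _; rewrite big_ord0 mul1r !ffunE.
  exists (fun P => P ord0) => [s _|P _]; first by rewrite ffunE.
  by apply/ffunP=> i; rewrite ffunE (ord1 i).
rewrite big_ord_recr /= -mulrA kernel_mxM IH [RHS]sum_ffun_rcons; apply: eq_bigr => P _.
rewrite mulr_sumr; apply: eq_bigr => u _; rewrite big_ord_recr /= -!mulrA.
have ord0_lift : ord0 = lift ord_max ord0 :> 'I_R.+2 by apply: ord_inj; rewrite lift_max.
have max_lift : ord_max = lift ord0 ord_max :> 'I_R.+2 by exact: val_inj.
congr (_ * (_ * _)).
- apply: eq_bigr => r _; rewrite widen_ord_lift_max ffun_rcons_lift.
  have -> : lift ord0 (lift ord_max r) = lift ord_max (lift ord0 r) :> 'I_R.+2.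
    by apply: val_inj; rewrite /= /bump /=; have := ltn_ord r; lia.
  by rewrite ffun_rcons_lift.
- by rewrite ffun_rcons_lift -max_lift ffun_rcons_max.
- by rewrite ffun_rcons_max ord0_lift ffun_rcons_lift.
Qed.

End ClosedWalks.

Section GridGraph.
Variables (R k : nat).

Definition grid_edge : finType := ('I_R.+1 * 'I_k + 'I_R * 'I_k.+1)%type.

Definition grid_ends (e : grid_edge) : ('I_R.+1 * 'I_k.+1) * ('I_R.+1 * 'I_k.+1) :=
  match e with
  | inl (r, i) => ((r, lift ord_max i), (r, lift ord0 i))
  | inr (r, i) => ((lift ord_max r, i), (lift ord0 r, i))
  end.

Section GridWord.
Variables (K : Type) (one : K) (c : grid_edge -> K).

Definition row_word (r : 'I_R.+1) : seq (nat * K) :=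
  [seq (i.*2.+1, c (inl (r, i))) | i : 'I_k <- index_enum _].

Definition col_word (r : 'I_R) : seq (nat * K) :=
  [seq (i.*2, c (inr (r, i))) | i : 'I_k.+1 <- index_enum _].

(* The last factor, of weight J, makes the trace sum freely over the last row. *)
Definition grid_word : seq (nat * K) :=
  flatten [seq row_word (lift ord_max r) ++ col_word r | r : 'I_R <- index_enum _] ++
  row_word ord_max ++ [seq (i.*2, one) | i : 'I_k.+1 <- index_enum _].

Lemma grid_word_bound : all (fun p => p.1 < k.*2.+1)%N grid_word.
Proof.
have row_bound r : all (fun p => p.1 < k.*2.+1)%N (row_word r).
  by rewrite all_map; apply/allP=> i _ /=; have := ltn_ord i; lia.
have sites_bound (w : 'I_k.+1 -> K) :
    all (fun p => p.1 < k.*2.+1)%N [seq (i.*2, w i) | i : 'I_k.+1 <- index_enum _].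
  by rewrite all_map; apply/allP=> i _ /=; have := ltn_ord i; lia.
rewrite !all_cat row_bound sites_bound andbT -big_all big_flatten big_map /=.
by rewrite big1 // => r _; rewrite big_all all_cat row_bound sites_bound.
Qed.

End GridWord.
End GridGraph.

Section GridTrace.
Variables (C : numClosedFieldType) (n R k : nat).
Variables (K : Type) (one : K) (mx : K -> 'M[C]_n) (c : grid_edge R k -> K).
Hypothesis mx_one : mx one = const_mx 1.
Local Notation state := {ffun 'I_k.+1 -> 'I_n}.
Local Notation word_mx s := (\prod_(p <- s) grid_gen k p.1 (mx p.2)).

Lemma grid_gen_bond (i : 'I_k) (M : 'M[C]_n) :
  grid_gen k i.*2.+1 M = bond_mx (lift ord_max i) (lift ord0 i) M.
Proof.
rewrite /grid_gen /= odd_double /= uphalf_double.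
by congr bond_mx; apply: ord_inj; rewrite inordK ?lift_max // ltnS ?(ltnW (ltn_ord i)).
Qed.

Lemma grid_gen_site (i : 'I_k.+1) (M : 'M[C]_n) : grid_gen k i.*2 M = site_mx i M.
Proof. by rewrite /grid_gen odd_double doubleK inord_val. Qed.

Definition row_weight (r : 'I_R.+1) (s : state) : C :=
  \prod_(i < k) mx (c (inl (r, i))) (s (lift ord_max i)) (s (lift ord0 i)).

Definition col_weight (r : 'I_R) (s s' : state) : C :=
  \prod_(i < k.+1) mx (c (inr (r, i))) (s i) (s' i).

Lemma row_word_mx r : word_mx (row_word c r) = mult_mx (row_weight r).
Proof.
rewrite /row_word big_map /= -prod_bond_mx.
by apply: eq_bigr => i _; rewrite grid_gen_bond.
Qed.

Lemma col_word_mx r : word_mx (col_word c r) = kernel_mx (col_weight r).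
Proof.
rewrite /col_word big_map /= -prod_site_mx.
by apply: eq_bigr => i _; rewrite grid_gen_site.
Qed.

Lemma last_word_mx :
  word_mx [seq (i.*2, one) | i : 'I_k.+1 <- index_enum _] = kernel_mx (fun s s' : state => 1).
Proof.
rewrite big_map /= (eq_bigr (fun i => site_mx i (const_mx 1))) => [|i _]; last first.
  by rewrite grid_gen_site mx_one.
rewrite prod_site_mx; apply: eq_kernel_mx => s s'.
by rewrite big1 // => i _; rewrite mxE.
Qed.

Lemma grid_weight_rows (P : {ffun 'I_R.+1 -> state}) :
  (\prod_(r < R) (row_weight (lift ord_max r) (P (lift ord_max r)) *
                  col_weight r (P (lift ord_max r)) (P (lift ord0 r)))) *
  row_weight ord_max (P ord_max) =
  \prod_(e : grid_edge R k)
    mx (c e) (P (grid_ends e).1.1 (grid_ends e).1.2) (P (grid_ends e).2.1 (grid_ends e).2.2).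
Proof.
rewrite big_split /= mulrAC big_sumType /=; congr (_ * _).
  transitivity (\prod_r row_weight r (P r)).
    by rewrite big_ord_recr /=; congr (_ * _); apply: eq_bigr => r _; rewrite widen_ord_lift_max.
  by rewrite pair_bigA; apply: eq_bigr => -[].
by rewrite pair_bigA; apply: eq_bigr => -[].
Qed.

Lemma mxtrace_grid_word :
  \tr (word_mx (grid_word one c)) = scaffold0 (@grid_ends R k) (fun e => mx (c e)).
Proof.
rewrite !big_cat /= row_word_mx last_word_mx mult_mxMl big_flatten big_map /=.
under eq_bigr do rewrite big_cat /= row_word_mx col_word_mx mult_mxMl.
rewrite mxtrace_prod_kernel_mx /scaffold0.
rewrite (reindex (fun P : {ffun 'I_R.+1 -> state} =>
   [ffun p : 'I_R.+1 * 'I_k.+1 => P p.1 p.2])) /=; last first.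
  exists (fun psi : {ffun 'I_R.+1 * 'I_k.+1 -> 'I_n} => [ffun r => [ffun i => psi (r, i)]]).
    by move=> P _; apply/ffunP=> r; apply/ffunP=> i; rewrite !ffunE.
  by move=> psi _; apply/ffunP=> -[r i]; rewrite !ffunE.
apply: eq_bigr => P _; rewrite mulr1 grid_weight_rows.
by apply: eq_bigr => e _; rewrite !ffunE.
Qed.

End GridTrace.

Theorem grid_scaffold_eq (C : numClosedFieldType) (n d R k : nat)
    (rel1 rel2 : 'I_n -> 'I_n -> 'I_d.+1) (E1 E2 : 'I_d.+1 -> 'M[C]_n) sigma t
    (c : grid_edge R k -> 'I_d.+1 -> C) :
  is_sym_assoc_scheme rel1 -> is_sym_assoc_scheme rel2 ->
  is_prim_idempotents rel1 E1 -> is_prim_idempotents rel2 E2 ->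
  exactly_triply_regular C rel1 -> exactly_triply_regular C rel2 ->
  is_DeltaWye rel1 E1 sigma -> is_DeltaWye rel2 E2 sigma ->
  trivial_idempotent E1 t -> trivial_idempotent E2 t ->
  scaffold0 (@grid_ends R k) (fun e => bmx rel1 (c e)) =
  scaffold0 (@grid_ends R k) (fun e => bmx rel2 (c e)).
Proof.
move=> scheme1 scheme2 prim1 prim2 etr1 etr2 dw1 dw2 Et1 Et2.
have [tau tauP] := sigma_linverse_exists sigma.
rewrite -!(mxtrace_grid_word _ (bmx_const1 _ _)).
apply: (markov_model_trace (M := k.*2.+1) (D := grid_constants n sigma tau t)
  (g1 := scheme_gen k rel1) (g2 := scheme_gen k rel2)) => //; last exact: grid_word_bound.
- exact: scheme_markov_model scheme1 prim1 etr1 dw1 tauP Et1.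
- exact: scheme_markov_model scheme2 prim2 etr2 dw2 tauP Et2.
Qed.

(** * Scaffolds of minors *)

Section GraphMinor.
Variables (V Ed P S : finType) (ends : Ed -> V * V) (hends : S -> P * P).

(* lab sends each vertex of the host graph to the branch set it belongs to, if any. *)
Definition minor_model (lab : P -> option V) : Prop :=
  [/\ forall v, exists p, lab p = Some v,
      forall p q v, lab p = Some v -> lab q = Some v ->
        connect [rel p q | (lab p == lab q) && gadj hends p q] p q &
      forall e, (ends e).1 != (ends e).2 -> exists p q,
        [/\ lab p = Some (ends e).1, lab q = Some (ends e).2 & gadj hends p q]].

Variable lab : P -> option V.
Hypothesis lab_minor : minor_model lab.

Definition carries (o : option S) (e : Ed) : Prop :=
  if o is Some s then
    lab (hends s).1 = Some (ends e).1 /\ lab (hends s).2 = Some (ends e).2 \/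
    lab (hends s).1 = Some (ends e).2 /\ lab (hends s).2 = Some (ends e).1
  else (ends e).1 = (ends e).2.

Lemma carries_exists : exists ch : Ed -> option S, forall e, carries (ch e) e.
Proof.
have [_ _ edges] := lab_minor.
apply: (fin_all_exists (P := fun e o => carries o e)) => e.
case: (eqVneq (ends e).1 (ends e).2) => [ee|ne]; first by exists None.
have [p [q [lp lq /existsP[s /orP[]/eqP hs]]]] := edges e ne; exists (Some s); rewrite /= hs.
  by left.
by right.
Qed.

Definition contracted (s : S) : bool :=
  (lab (hends s).1 == lab (hends s).2) && (lab (hends s).1 != None).

Section Weights.
Variables (C : numClosedFieldType) (n : nat) (w : Ed -> 'M[C]_n) (ch : Ed -> option S).
Hypothesis w_sym : forall e, (w e)^T = w e.
Hypothesis chP : forall e, carries (ch e) e.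
Implicit Types (psi : {ffun P -> 'I_n}) (phi : {ffun V -> 'I_n}).

Definition minor_weight (s : S) : 'M[C]_n :=
  \matrix_(x, y) ((if contracted s then (x == y)%:R else 1) *
                  \prod_(e | ch e == Some s) w e x y).

Definition consistent psi : bool :=
  [forall s, contracted s ==> (psi (hends s).1 == psi (hends s).2)].

Lemma prod_minor_weight psi :
  \prod_s minor_weight s (psi (hends s).1) (psi (hends s).2) =
  (consistent psi)%:R *
  \prod_e (if ch e is Some s then w e (psi (hends s).1) (psi (hends s).2) else 1).
Proof.
under eq_bigr do rewrite mxE; rewrite big_split /=; congr (_ * _).
  case: (boolP (consistent psi)) => [/forallP cons|/forallPn[s]]; first rewrite big1 // => s _.
    by have := cons s; case: contracted => //= /eqP->; rewrite eqxx.
  rewrite negb_imply => /andP[cs /negbTE psi_s].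
  by rewrite (bigD1 s) //= cs psi_s mul0r.
rewrite (exchange_big_dep predT) //=; apply: eq_bigr => e _.
case: (ch e) => [s|]; last by rewrite big_pred0.
by rewrite (big_pred1 s) // => s' /=; rewrite eq_sym.
Qed.

Lemma consistent_lab psi p q v : consistent psi ->
  lab p = Some v -> lab q = Some v -> psi p = psi q.
Proof.
have [_ branch_connected _] := lab_minor; move=> /forallP cons lp lq.
have /connectP[path] := branch_connected p q v lp lq.
elim: path p lp => [|p' path IH] p lp /=; first by move=> _ ->.
move=> /andP[/andP[/eqP lpp' /existsP[s hs]] pth] q_last.
have lp' : lab p' = Some v by rewrite -lpp'.
rewrite -(IH p' lp' pth q_last); have := cons s.
by case/orP: hs => /eqP hs; rewrite /contracted hs /= lp lp' eqxx => /eqP.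
Qed.

Variable rep : V -> P.
Hypothesis repP : forall v, lab (rep v) = Some v.

Definition on_branches psi : {ffun V -> 'I_n} := [ffun v => psi (rep v)].

Lemma consistent_edge psi e s : consistent psi -> ch e = Some s ->
  w e (psi (hends s).1) (psi (hends s).2) =
  w e (on_branches psi (ends e).1) (on_branches psi (ends e).2).
Proof.
move=> cons che; have := chP e; rewrite che !ffunE /= => -[[l1 l2]|[l1 l2]].
  by rewrite (consistent_lab cons l1 (repP _)) (consistent_lab cons l2 (repP _)).
by rewrite (consistent_lab cons l1 (repP _)) (consistent_lab cons l2 (repP _)) -{1}w_sym mxE.
Qed.

Definition branch_values phi (p : P) : pred 'I_n :=
  [pred x | if lab p is Some v then x == phi v else true].

Lemma consistent_fiber phi psi :
  consistent psi && (on_branches psi == phi) = (psi \in family (branch_values phi)).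
Proof.
apply/andP/familyP => [[cons /eqP <-] p|fam].
  rewrite inE; case: (lab p) (@consistent_lab psi p) => [v lab_p|] //.
  by rewrite ffunE (lab_p (rep v) v).
have psiE p v : lab p = Some v -> psi p = phi v.
  by move=> lp; have := fam p; rewrite inE lp => /eqP.
split; last by apply/eqP/ffunP=> v; rewrite ffunE (psiE _ v).
apply/forallP=> s; apply/implyP=> /andP[/eqP ls].
case l1: (lab (hends s).1) => [v|] // _; apply/eqP.
by rewrite (psiE _ v) // (psiE _ v) // -ls.
Qed.

Definition free_count : C := \prod_p (if lab p is Some _ then 1 else n%:R).

Lemma sum_consistent_fiber phi :
  \sum_(psi | consistent psi && (on_branches psi == phi)) 1 = free_count.
Proof.
rewrite (eq_bigl _ _ (consistent_fiber phi)).
transitivity (\sum_(psi in family (branch_values phi)) \prod_(p : P) (1 : C)).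
  by apply: eq_bigr => psi _; rewrite big1.
rewrite -(bigA_distr_big_dep _ (fun _ _ => 1)) /=; apply: eq_bigr => p _.
rewrite /branch_values; case: (lab p) => [v|]; first by rewrite big_pred1_eq.
by rewrite sumr_const card_ord.
Qed.

Theorem scaffold_minor (dg : Ed -> C) : (forall e x, w e x x = dg e) ->
  scaffold0 hends minor_weight * \prod_(e | ch e == None) dg e = free_count * scaffold0 ends w.
Proof.
move=> w_diag.
pose term phi := \prod_e w e (phi (ends e).1) (phi (ends e).2).
transitivity (\sum_(psi | consistent psi) term (on_branches psi)).
  rewrite mulr_suml [RHS]big_mkcond; apply: eq_bigr => psi _; rewrite prod_minor_weight.
  case: (boolP (consistent psi)) => [cons|_]; last by rewrite !mul0r.
  rewrite mul1r [X in _ * X]big_mkcond -big_split /=; apply: eq_bigr => e _.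
  case che: (ch e) => [s|]; first by rewrite mulr1 (consistent_edge cons che).
  by have := chP e; rewrite che /= => ->; rewrite w_diag mul1r.
rewrite (partition_big on_branches predT) //= mulr_sumr; apply: eq_bigr => phi _.
rewrite -(sum_consistent_fiber phi) mulr_suml.
by apply: eq_bigr => psi /andP[_ /eqP->]; rewrite mul1r.
Qed.

Lemma free_count_neq0 : (0 < n)%N -> free_count != 0.
Proof.
move=> n_gt0; apply/prodf_neq0 => p _.
by case: (lab p) => [_|]; rewrite ?oner_neq0 // pnatr_eq0 -lt0n.
Qed.

End Weights.

Lemma minor_weight_bmx (C : numClosedFieldType) (n d : nat) (rel : 'I_n -> 'I_n -> 'I_d.+1)
    (ch : Ed -> option S) (c : Ed -> 'I_d.+1 -> C) s : is_sym_assoc_scheme rel ->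
  minor_weight (fun e => bmx rel (c e)) ch s =
  bmx rel (fun l => (if contracted s then (l == ord0)%:R else 1) *
                    \prod_(e | ch e == Some s) c e l).
Proof.
move=> scheme; apply/matrixP=> x y; rewrite mxE bmxE rel_eq0 //; congr (_ * _).
by apply: eq_bigr => e _; rewrite bmxE.
Qed.

End GraphMinor.

Lemma eq_scaffold0 (C : numClosedFieldType) (n : nat) (V Ed : finType) (ends : Ed -> V * V)
    (w w' : Ed -> 'M[C]_n) : w =1 w' -> scaffold0 ends w = scaffold0 ends w'.
Proof. by move=> ww'; apply: eq_bigr => phi _; apply: eq_bigr => e _; rewrite ww'. Qed.

Theorem minor_scaffold_eq (C : numClosedFieldType) (n d : nat)
    (rel1 rel2 : 'I_n -> 'I_n -> 'I_d.+1) (V Ed P S : finType)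
    (ends : Ed -> V * V) (hends : S -> P * P) (lab : P -> option V) :
  is_sym_assoc_scheme rel1 -> is_sym_assoc_scheme rel2 ->
  minor_model ends hends lab ->
  (forall c : S -> 'I_d.+1 -> C, scaffold0 hends (fun s => bmx rel1 (c s)) =
                                 scaffold0 hends (fun s => bmx rel2 (c s))) ->
  forall c : Ed -> 'I_d.+1 -> C, scaffold0 ends (fun e => bmx rel1 (c e)) =
                                 scaffold0 ends (fun e => bmx rel2 (c e)).
Proof.
move=> scheme1 scheme2 lab_minor host_eq c.
have [ch chP] := carries_exists lab_minor.
have [/fin_all_exists[rep repP] _ _] := lab_minor.
have reduce (rel : 'I_n -> 'I_n -> 'I_d.+1) : is_sym_assoc_scheme rel ->
    free_count lab C n * scaffold0 ends (fun e => bmx rel (c e)) =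
    scaffold0 hends (minor_weight hends lab (fun e => bmx rel (c e)) ch) *
    \prod_(e | ch e == None) c e ord0.
  move=> scheme; apply/esym/(scaffold_minor lab_minor _ chP repP) => [e|e x].
    exact: tr_bmx.
  exact: bmx_diag.
apply: (mulfI (free_count_neq0 lab C (scheme_order_gt0 scheme1))); rewrite !reduce //.
congr (_ * _); rewrite (eq_scaffold0 _ (fun s => minor_weight_bmx _ _ _ _ _ scheme1)).
by rewrite (eq_scaffold0 _ (fun s => minor_weight_bmx _ _ _ _ _ scheme2)).
Qed.

(** * Pixelated drawings are grid minors *)

Section PixelDrawing.
Variables (V Ed : finType) (ends : Ed -> V * V).

Definition touching (o o' : V + Ed) : bool :=
  match o, o' with
  | inl u, inl v => u == v
  | inr e, inr e' => e == e'
  | inl u, inr e | inr e, inl u => (u == (ends e).1) || (u == (ends e).2)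
  end.

Definition near (p p' : nat * nat) : Prop :=
  p.1 = p'.1 /\ (p.2 <= p'.2.+1)%N /\ (p'.2 <= p.2.+1)%N \/
  p.2 = p'.2 /\ (p.1 <= p'.1.+1)%N /\ (p'.1 <= p.1.+1)%N.

Variables (a b L : nat) (base : V -> nat * nat) (path : Ed -> nat -> nat * nat).

Definition occupies (o : V + Ed) (p : nat * nat) : Prop :=
  match o with
  | inl u => base u = p \/ exists e l, path e l = p /\
      ((l <= a)%N /\ (ends e).1 = u \/ (b <= l <= L)%N /\ (ends e).2 = u)
  | inr e => exists l, path e l = p /\ (a <= l <= b)%N
  end.

Record pixel_drawing : Prop := PixelDrawing {
  path_cuts : (a <= b <= L)%N;
  path_first : forall e, path e 0 = base (ends e).1;
  path_last : forall e, path e L = base (ends e).2;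
  path_near : forall e l, (l < L)%N -> near (path e l) (path e l.+1);
  occupies_touching : forall o o' p, occupies o p -> occupies o' p -> touching o o'
}.

Hypothesis drawing : pixel_drawing.

Lemma occupies_path e l : (l <= L)%N ->
  [\/ occupies (inl (ends e).1) (path e l), occupies (inl (ends e).2) (path e l)
    | occupies (inr e) (path e l)].
Proof.
have /andP[ab bL] := path_cuts drawing; move=> lL; case: (leqP l a) => la.
  by apply: Or31; right; exists e, l; split=> //; left.
case: (leqP b l) => lb; last by apply: Or33; exists l; split=> //; lia.
by apply: Or32; right; exists e, l; split=> //; right; split=> //; lia.
Qed.

Definition bridge e (i j : nat) : Prop :=
  [/\ (i < j <= L)%N, occupies (inl (ends e).1) (path e i),
      occupies (inl (ends e).2) (path e j) &
      forall l, (i < l < j)%N ->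
        occupies (inr e) (path e l) /\ forall u, ~ occupies (inl u) (path e l)].

(* From the last visit to the first end to the next visit to the second end. *)
Lemma bridge_exists e : (ends e).1 != (ends e).2 -> exists i j, bridge e i j.
Proof.
move=> ends_neq.
pose visits_first l := (l <= L)%N && boolp.asbool (occupies (inl (ends e).1) (path e l)).
have first_visited : exists l, visits_first l.
  by exists 0%N; apply/andP; split=> //; apply/boolp.asboolP; left; rewrite path_first.
have visits_first_le l : visits_first l -> (l <= L)%N by case/andP.
case: (ex_maxnP first_visited visits_first_le) => i /andP[iL /boolp.asboolP occ_i] i_max.
have i_neqL : i != L.
  apply: contraNneq ends_neq => iE; have occ_L : occupies (inl (ends e).2) (path e i).
    by left; rewrite iE path_last.
  exact: (occupies_touching drawing occ_i occ_L).
pose visits_last l := (i < l <= L)%N && boolp.asbool (occupies (inl (ends e).2) (path e l)).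
have last_visited : exists l, visits_last l.
  exists L; apply/andP; split; first lia.
  by apply/boolp.asboolP; left; rewrite path_last.
case: (ex_minnP last_visited) => j /andP[ijL /boolp.asboolP occ_j] j_min.
exists i, j; split=> // l ilj; have lL : (l <= L)%N by lia.
have not_first : ~ occupies (inl (ends e).1) (path e l).
  move=> occ_l; suff : (l <= i)%N by lia.
  by apply: i_max; rewrite /visits_first lL boolp.asboolT.
have not_last : ~ occupies (inl (ends e).2) (path e l).
  move=> occ_l; suff : (j <= l)%N by lia.
  by apply: j_min; rewrite /visits_last boolp.asboolT // andbT; lia.
have [//|//|occ_e] := occupies_path e lL; split=> // u occ_u.
by have /orP[/eqP uE|/eqP uE] := occupies_touching drawing occ_e occ_u; rewrite uE in occ_u.
Qed.

Definition territory (u : V) (p : nat * nat) : Prop :=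
  occupies (inl u) p \/
  exists e i j l, [/\ bridge e i j, (ends e).1 = u, (i < l < j)%N & path e l = p].

Lemma territory_inj u v p : territory u p -> territory v p -> u = v.
Proof.
move=> [occ_u|[e [i [j [l [[_ _ _ inner] <- ilj lp]]]]]].
all: move=> [occ_v|[e' [i' [j' [l' [[_ _ _ inner'] <- ilj' lp']]]]]].
- exact/eqP/(occupies_touching drawing occ_u occ_v).
- by have [_ /(_ u)] := inner' l' ilj'; rewrite lp' => /(_ occ_u).
- by have [_ /(_ v)] := inner l ilj; rewrite lp => /(_ occ_v).
have [[occ_e _] [occ_e' _]] := (inner l ilj, inner' l' ilj'); rewrite lp' -lp in occ_e'.
by have /eqP -> := occupies_touching drawing occ_e occ_e'.
Qed.

Definition in_box N (p : nat * nat) : bool := (p.1 <= N)%N && (p.2 <= N)%N.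

Lemma territory_bounded : exists N, forall u p, territory u p -> in_box N p.
Proof.
have [N baseN pathN] : exists2 N, forall v, in_box N (base v)
    & forall e l, (l <= L)%N -> in_box N (path e l).
  pose size_at (p : nat * nat) := (p.1 + p.2)%N.
  have box N p : (size_at p <= N)%N -> in_box N p.
    by case: p => x y; rewrite /size_at /in_box /=; lia.
  exists (\max_v size_at (base v) + \max_(el : Ed * 'I_L.+1) size_at (path el.1 el.2))%N.
    move=> v; apply: box; apply: leq_trans (leq_addr _ _).
    exact: (leq_bigmax (F := fun v => size_at (base v))).
  move=> e l lL; apply: box; apply: leq_trans (leq_addl _ _).
  rewrite -{1}(@inordK L l) //.
  exact: (leq_bigmax (F := fun el : Ed * 'I_L.+1 => size_at (path el.1 el.2)) (e, inord l)).
have /andP[ab bL] := path_cuts drawing.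
exists N => u p [[<-//|[e [l [<- h]]]]|[e [i [j [l [[ijL _ _ _] _ ilj <-]]]]]].
  by apply: pathN; case: h => [[la _]|[/andP[_ ?] _]] //; lia.
by apply: pathN; lia.
Qed.

Variable N : nat.
Hypothesis territory_box : forall u p, territory u p -> in_box N p.
Local Notation pixel := ('I_N.+1 * 'I_N.+1)%type.

Definition coords (p : pixel) : nat * nat := (p.1 : nat, p.2 : nat).
Definition pixel_at (p : nat * nat) : pixel := (inord p.1, inord p.2).

Lemma coordsK p : pixel_at (coords p) = p.
Proof. by case: p => r i; rewrite /pixel_at /coords /= !inord_val. Qed.

Lemma pixel_atK p : in_box N p -> coords (pixel_at p) = p.
Proof. by case: p => r i /andP[/= rN iN]; rewrite /coords /pixel_at /= !inordK. Qed.

Lemma gadj_sym (W F : finType) (f : F -> W * W) (u v : W) : gadj f u v = gadj f v u.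
Proof. by apply: eq_existsb => e; rewrite orbC. Qed.

Lemma lift_inord (y : nat) (yN : (y < N)%N) :
  lift ord_max (Ordinal yN) = inord y :> 'I_N.+1 /\ lift ord0 (Ordinal yN) = inord y.+1 :> 'I_N.+1.
Proof.
by split; apply: ord_inj; rewrite ?lift_max ?lift0 inordK //= ltnS // ltnW.
Qed.

Lemma near_gadj p p' : in_box N p -> in_box N p' -> near p p' -> p <> p' ->
  gadj (@grid_ends N N) (pixel_at p) (pixel_at p').
Proof.
have right x y : (y < N)%N -> gadj (@grid_ends N N) (pixel_at (x, y)) (pixel_at (x, y.+1)).
  move=> yN; have [liftm lift0] := lift_inord yN.
  by apply/existsP; exists (inl (inord x, Ordinal yN)); rewrite /= liftm lift0 eqxx.
have down x y : (x < N)%N -> gadj (@grid_ends N N) (pixel_at (x, y)) (pixel_at (x.+1, y)).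
  move=> xN; have [liftm lift0] := lift_inord xN.
  by apply/existsP; exists (inr (Ordinal xN, inord y)); rewrite /= liftm lift0 eqxx.
case: p p' => [x y] [x' y'] /andP[/= xN yN] /andP[/= x'N y'N] [] [/= <- [le1 le2]] neq.
  have [eq_y|[eq_y|eq_y]] : y' = y.+1 \/ y = y'.+1 \/ y = y' by lia.
  - by rewrite eq_y; apply: right; lia.
  - by rewrite eq_y gadj_sym; apply: right; lia.
  - by case: neq; rewrite eq_y.
have [eq_x|[eq_x|eq_x]] : x' = x.+1 \/ x = x'.+1 \/ x = x' by lia.
- by rewrite eq_x; apply: down; lia.
- by rewrite eq_x gadj_sym; apply: down; lia.
- by case: neq; rewrite eq_x.
Qed.

Definition territory_label (p : pixel) : option V :=
  [pick u | boolp.asbool (territory u (coords p))].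

Lemma territory_labelP p u : territory_label p = Some u <-> territory u (coords p).
Proof.
rewrite /territory_label; case: pickP => [v /boolp.asboolP terr_v|no_terr].
  by split=> [[<-]|terr_u] //; rewrite (territory_inj terr_v terr_u).
by split=> // terr_u; have := no_terr u; rewrite boolp.asboolT.
Qed.

Lemma territory_label_at u p : territory u p -> territory_label (pixel_at p) = Some u.
Proof. by move=> terr_p; apply/territory_labelP; rewrite pixel_atK // (territory_box terr_p). Qed.

Let link := [rel p q | (territory_label p == territory_label q) && gadj (@grid_ends N N) p q].

Lemma link_sym : connect_sym link.
Proof. by apply: sym_connect_sym => p q /=; rewrite eq_sym gadj_sym. Qed.

Lemma territory_near_connect u p p' : territory u p -> territory u p' -> near p p' ->
  connect link (pixel_at p) (pixel_at p').
Proof.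
move=> terr_p terr_p' near_pp'; have [->|/eqP neq] := eqVneq p p'; first exact: connect0.
apply: connect1; rewrite /= !(territory_label_at terr_p, territory_label_at terr_p') eqxx.
exact: near_gadj (territory_box terr_p) (territory_box terr_p') near_pp' neq.
Qed.

Lemma territory_path_connect u e i j : (i <= j <= L)%N ->
  (forall l, (i <= l <= j)%N -> territory u (path e l)) ->
  connect link (pixel_at (path e i)) (pixel_at (path e j)).
Proof.
move=> /andP[]; elim: j => [|j IH] ij jL terr; first by have -> : i = 0%N by lia.
move: ij; rewrite leq_eqVlt => /predU1P[->|ij]; first exact: connect0.
apply: (connect_trans (IH _ _ _)); [lia | lia | by move=> l ?; apply: terr; lia |].
by apply: (@territory_near_connect u); [apply: terr; lia.. | exact: path_near].
Qed.

Lemma territory_connect_base u p : territory u p ->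
  connect link (pixel_at (base u)) (pixel_at p).
Proof.
have occupied_connect p' : occupies (inl u) p' -> connect link (pixel_at (base u)) (pixel_at p').
  move=> [->|[e [l [<- [[la eu]|[lb eu]]]]]]; first exact: connect0.
    rewrite -eu -(path_first drawing); apply: (@territory_path_connect u).
      by have := path_cuts drawing; lia.
    by move=> l' l'l; left; right; exists e, l'; split=> //; left; split=> //; lia.
  rewrite -eu -(path_last drawing) link_sym; apply: (@territory_path_connect u); first lia.
  by move=> l' l'l; left; right; exists e, l'; split=> //; right; split=> //; lia.
move=> [/occupied_connect //|[e [i [j [l [br eu ilj <-]]]]]].
have [ijL occ_i _ _] := br; rewrite eu in occ_i.
apply: connect_trans (occupied_connect _ occ_i) _.
apply: (@territory_path_connect u); first lia.
move=> l' /andP[]; rewrite leq_eqVlt => /predU1P[<-|il'] l'l; first by left.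
by right; exists e, i, j, l'; split=> //; lia.
Qed.

Lemma territory_edge e : (ends e).1 != (ends e).2 -> exists p q,
  [/\ territory (ends e).1 p, territory (ends e).2 q & near p q].
Proof.
move=> /bridge_exists[i [j br]]; have [ijL occ_i occ_j _] := br.
exists (path e j.-1), (path e j); split; last 1 first.
- by rewrite -{2}(@prednK j); [apply: path_near drawing _ _ _; lia | lia].
- have [<-|ij] : i = j.-1 \/ (i < j.-1)%N by lia.
    by left.
  by right; exists e, i, j, j.-1; split=> //; lia.
- by left.
Qed.

Lemma territory_minor_model : minor_model ends (@grid_ends N N) territory_label.
Proof.
split=> [v|p q v /territory_labelP terr_p /territory_labelP terr_q|e ends_neq].
- by exists (pixel_at (base v)); apply: territory_label_at; left; left.
- rewrite -[p]coordsK -[q]coordsK; apply: (@connect_trans _ _ (pixel_at (base v))).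
    by rewrite link_sym; exact: territory_connect_base.
  exact: territory_connect_base.
have [p [q [terr_p terr_q near_pq]]] := territory_edge ends_neq.
exists (pixel_at p), (pixel_at q); split; [exact: territory_label_at..|].
apply: near_gadj (territory_box terr_p) (territory_box terr_q) near_pq _ => pq.
by move: ends_neq; rewrite (territory_inj terr_p (v := (ends e).2)) ?eqxx // pq.
Qed.

End PixelDrawing.

Theorem pixel_drawing_minor (V Ed : finType) (ends : Ed -> V * V) a b L base path :
  pixel_drawing ends a b L base path ->
  exists N lab, minor_model ends (@grid_ends N N) lab.
Proof.
move=> drawing; have [N box] := territory_bounded drawing.
by exists N, (@territory_label _ _ ends a b L base path N); exact: territory_minor_model.
Qed.

(** * Planar graphs are grid minors *)

Section PlaneCurves.
Local Open Scope R_scope.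
Implicit Types (p q : R * R) (f g : R -> R * R).

Definition sup_dist p q : R := Rmax (Rabs (p.1 - q.1)) (Rabs (p.2 - q.2)).

Lemma sup_dist_lt p q eps :
  sup_dist p q < eps <-> Rabs (p.1 - q.1) < eps /\ Rabs (p.2 - q.2) < eps.
Proof.
rewrite /sup_dist; split=> [|[lt1 lt2]]; last exact: Rmax_lub_lt.
have := Rmax_l (Rabs (p.1 - q.1)) (Rabs (p.2 - q.2)).
by have := Rmax_r (Rabs (p.1 - q.1)) (Rabs (p.2 - q.2)); lra.
Qed.

Lemma sup_distC p q : sup_dist p q = sup_dist q p.
Proof. by rewrite /sup_dist Rabs_minus_sym (Rabs_minus_sym p.2). Qed.

Lemma sup_dist_triangle p q r : sup_dist p r <= sup_dist p q + sup_dist q r.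
Proof.
have tri x y z : Rabs (x - z) <= Rabs (x - y) + Rabs (y - z) by split_Rabs; lra.
by apply: Rmax_lub; apply: Rle_trans (tri _ _ _) _; apply: Rplus_le_compat;
  (exact: Rmax_l || exact: Rmax_r).
Qed.

Lemma sup_dist_gt0 p q : p <> q -> 0 < sup_dist p q.
Proof.
case: p q => [x y] [x' y'] neq; have [xx'|neq_x] := boolp.pselect (x = x').
  apply: Rlt_le_trans (Rmax_r _ _); apply: Rabs_pos_lt => /= yy'.
  by apply: neq; rewrite xx' (Rminus_diag_uniq _ _ yy').
by apply: Rlt_le_trans (Rmax_l _ _); apply: Rabs_pos_lt; exact: Rminus_eq_contra.
Qed.

Lemma sup_dist_refl p : sup_dist p p = 0.
Proof. by rewrite /sup_dist !Rminus_diag Rabs_R0 Rmax_left //; lra. Qed.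

Definition continuous_curve f : Prop := forall t eps, unitI t -> 0 < eps ->
  exists alp, 0 < alp /\ forall x, unitI x -> Rabs (x - t) < alp -> sup_dist (f x) (f t) < eps.

Lemma continuous_curve_const p : continuous_curve (fun=> p).
Proof. by move=> t eps _ eps0; exists 1; split; [lra | move=> x _ _; rewrite sup_dist_refl]. Qed.

Lemma continuous_curve_pair (fx fy : R -> R) :
  (forall t, unitI t -> continue_in fx unitI t /\ continue_in fy unitI t) ->
  continuous_curve (fun t => (fx t, fy t)).
Proof.
move=> cont t eps ut eps0.
have coord (h : R -> R) : continue_in h unitI t -> exists alp, 0 < alp /\
    forall x, unitI x -> Rabs (x - t) < alp -> Rabs (h x - h t) < eps.
  move=> /(_ eps eps0)[alp [alp0 h_near]]; exists alp; split=> // x ux xt.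
  have [->|neq] := boolp.pselect (x = t); first by rewrite Rminus_diag Rabs_R0.
  by apply: h_near; split=> //; split=> //; exact/nesym.
have [cx cy] := cont t ut.
have [[a1 [a10 near1]] [a2 [a20 near2]]] := (coord _ cx, coord _ cy).
exists (Rmin a1 a2); split; first exact: Rmin_glb_lt.
move=> x ux xt; have := Rmin_l a1 a2; have := Rmin_r a1 a2.
by move=> ? ?; apply/sup_dist_lt; split; [apply: near1 | apply: near2] => //; lra.
Qed.

Lemma continuous_curve_uniform f eps : continuous_curve f -> 0 < eps ->
  exists d, 0 < d /\ forall x y, unitI x -> unitI y -> Rabs (x - y) < d ->
    sup_dist (f x) (f y) < eps.
Proof.
move=> cf eps0.
have /boolp.choice[delta deltaP] : forall u, exists dl : posreal, unitI u ->
    forall x, unitI x -> Rabs (x - u) < 2 * dl -> sup_dist (f x) (f u) < eps / 2.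
  move=> u; have [uu|nu] := boolp.pselect (unitI u); last by exists (mkposreal 1 Rlt_0_1).
  have [|alp [alp0 near_u]] := cf u (eps / 2) uu; first lra.
  have alp2 : 0 < alp / 2 by lra.
  by exists (mkposreal _ alp2) => _ x ux /= xu; apply: near_u => //; lra.
have [d dP] := Compactness.compactness_value_1d 0 1 delta.
exists d; split=> [|x y ux uy xy]; first exact: cond_pos.
apply: boolp.contrapT => far; apply: (dP x ux) => -[u [uu [xu du]]]; apply: far.
have delta0 := cond_pos (delta u).
have fx : sup_dist (f x) (f u) < eps / 2 by apply: deltaP => //; lra.
have fy : sup_dist (f y) (f u) < eps / 2.
  by apply: deltaP => //; move: xy xu; split_Rabs; lra.
by have := sup_dist_triangle (f x) (f u) (f y); rewrite (sup_distC (f u)); lra.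
Qed.

Lemma rectangle_bounded_below (F : R -> R -> R) s0 s1 t0 t1 :
  (forall u v, s0 <= u <= s1 -> t0 <= v <= t1 -> exists dl, 0 < dl /\
    forall s t, s0 <= s <= s1 -> t0 <= t <= t1 -> Rabs (s - u) < dl -> Rabs (t - v) < dl ->
    dl <= F s t) ->
  exists eps, 0 < eps /\ forall s t, s0 <= s <= s1 -> t0 <= t <= t1 -> eps <= F s t.
Proof.
move=> loc.
have /boolp.choice[delta deltaP] : forall uv : R * R, exists dl : posreal,
    s0 <= uv.1 <= s1 -> t0 <= uv.2 <= t1 -> forall s t, s0 <= s <= s1 -> t0 <= t <= t1 ->
    Rabs (s - uv.1) < dl -> Rabs (t - uv.2) < dl -> dl <= F s t.
  move=> [u v]; have [[us vt]|out] := boolp.pselect (s0 <= u <= s1 /\ t0 <= v <= t1).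
    by have [dl [dl0 dlP]] := loc u v us vt; exists (mkposreal dl dl0).
  by exists (mkposreal 1 Rlt_0_1) => us vt; case: out.
have [d dP] := Compactness.compactness_value_2d s0 s1 t0 t1 (fun u v => delta (u, v)).
exists d; split=> [|s t hs ht]; first exact: cond_pos.
apply: boolp.contrapT => small; apply: (dP s t hs ht) => -[u [v [hu [hv [su [tv dd]]]]]].
by apply: small; apply: Rle_trans dd _; exact: (deltaP (u, v)).
Qed.

Lemma disjoint_arcs_dist f g s0 s1 t0 t1 :
  continuous_curve f -> continuous_curve g ->
  0 <= s0 -> s1 <= 1 -> 0 <= t0 -> t1 <= 1 ->
  (forall s t, s0 <= s <= s1 -> t0 <= t <= t1 -> f s <> g t) ->
  exists eps, 0 < eps /\ forall s t, s0 <= s <= s1 -> t0 <= t <= t1 ->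
    eps <= sup_dist (f s) (g t).
Proof.
move=> cf cg s0_ge0 s1_le1 t0_ge0 t1_le1 disj; apply: rectangle_bounded_below => u v us vt.
have [r r0 rE] : exists2 r, 0 < r & 4 * r = sup_dist (f u) (g v).
  by have := sup_dist_gt0 (disj u v us vt); exists (sup_dist (f u) (g v) / 4); lra.
have [|a1 [a10 near_u]] := cf u r _ r0; first by split; lra.
have [|a2 [a20 near_v]] := cg v r _ r0; first by split; lra.
exists (Rmin r (Rmin a1 a2)); split; first by do !apply: Rmin_glb_lt.
move=> s t hs ht su tv; have le_min := Rmin_r r (Rmin a1 a2).
have [le_a1 le_a2] := (Rmin_l a1 a2, Rmin_r a1 a2).
have f_close : sup_dist (f s) (f u) < r by apply: near_u; [split; lra | lra].
have g_close : sup_dist (g t) (g v) < r by apply: near_v; [split; lra | lra].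
apply: Rle_trans (Rmin_l _ _) _.
have := sup_dist_triangle (f u) (f s) (g v); have := sup_dist_triangle (f s) (g t) (g v).
by rewrite (sup_distC (f u) (f s)) -rE; lra.
Qed.

Lemma fin_common_pos (J : finType) (P : J -> R -> Prop) :
  (forall j e e', P j e -> 0 < e' <= e -> P j e') ->
  (forall j, exists e, 0 < e /\ P j e) -> exists e, 0 < e /\ forall j, P j e.
Proof.
move=> mono ex.
suff [e [e0 eP]] : exists e, 0 < e /\ forall j, j \in enum J -> P j e.
  by exists e; split=> // j; apply: eP; rewrite mem_enum.
elim: (enum J) => [|j s [e [e0 eP]]]; first by exists 1; split=> //; lra.
have [e1 [e10 Pe1]] := ex j; have min0 : 0 < Rmin e e1 by exact: Rmin_glb_lt.
exists (Rmin e e1); split=> // j'; rewrite inE => /predU1P[->|/eP Pj'].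
  by apply: mono Pe1 _; split=> //; exact: Rmin_r.
by apply: mono Pj' _; split=> //; exact: Rmin_l.
Qed.

Lemma fin_bounded (J : finType) (f : J -> R) : exists B, 0 < B /\ forall j, Rabs (f j) <= B.
Proof.
have [j e e' h [e'0 e'e]|j|e [e0 eP]] := @fin_common_pos J (fun j e => Rabs (f j) <= / e).
- by apply: Rle_trans h _; apply: Rinv_le_contravar.
- have abs_ge0 := Rabs_pos (f j).
  exists (/ (Rabs (f j) + 1)); split; first by apply: Rinv_0_lt_compat; lra.
  by rewrite Rinv_inv; lra.
- by exists (/ e); split=> //; exact: Rinv_0_lt_compat.
Qed.

End PlaneCurves.

Section Pixelation.
Local Open Scope R_scope.

Definition nat_floor (x : R) : nat := Z.to_nat (Int_part x).

Lemma nat_floorP x : 0 <= x -> INR (nat_floor x) <= x < INR (nat_floor x) + 1.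
Proof.
move=> x0; have [le_x gt_x] := base_Int_part x.
have Int_ge0 : Z.le Z0 (Int_part x).
  by apply/Z.lt_succ_r/lt_IZR; rewrite succ_IZR; lra.
rewrite /nat_floor INR_IZR_INZ (_ : Z.of_nat _ = Int_part x); last lia.
by split; lra.
Qed.

Variables (B dl : R).
Hypothesis dl0 : 0 < dl.
Implicit Types (x y : R) (z : R * R).

Definition pixel_coord x : nat := nat_floor ((x + B) / dl).

Lemma pixel_coordP x : Rabs x <= B ->
  INR (pixel_coord x) * dl <= x + B < (INR (pixel_coord x) + 1) * dl.
Proof.
move=> xB; have x0 : 0 <= x + B by move: xB; split_Rabs; lra.
have [] := @nat_floorP ((x + B) / dl) (Rle_mult_inv_pos _ _ x0 dl0).
rewrite -/(pixel_coord x) => le_x lt_x.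
have divK : (x + B) / dl * dl = x + B by rewrite /Rdiv Rmult_assoc Rinv_l ?Rmult_1_r //; lra.
by rewrite -divK; split; [apply: Rmult_le_compat_r; lra | apply: Rmult_lt_compat_r].
Qed.

Lemma pixel_coord_close x y : Rabs x <= B -> Rabs y <= B -> Rabs (x - y) < dl ->
  (pixel_coord x <= (pixel_coord y).+1)%N.
Proof.
move=> xB yB xy; have [le_x _] := pixel_coordP xB; have [_ lt_y] := pixel_coordP yB.
rewrite -ltnS; apply/ssrnat.ltP/INR_lt; rewrite !S_INR.
by apply: (Rmult_lt_reg_r dl) => //; move: xy; split_Rabs; lra.
Qed.

Lemma pixel_coord_eq_close x y : Rabs x <= B -> Rabs y <= B ->
  pixel_coord x = pixel_coord y -> Rabs (x - y) < dl.
Proof.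
move=> xB yB xy; have [le_x lt_x] := pixel_coordP xB; have := pixel_coordP yB.
by rewrite -xy => -[le_y lt_y]; split_Rabs; lra.
Qed.

Definition in_square z : Prop := Rabs z.1 <= B /\ Rabs z.2 <= B.

Definition pixel_of z : nat * nat := (pixel_coord z.1, pixel_coord z.2).

Definition shadow z (p : nat * nat) : Prop :=
  exists z', [/\ in_square z', sup_dist z z' < dl & pixel_of z' = p].

Lemma shadow_pixel_of z : in_square z -> shadow z (pixel_of z).
Proof. by move=> zB; exists z; rewrite sup_dist_refl. Qed.

Lemma shadow_close z1 z2 p : shadow z1 p -> shadow z2 p -> sup_dist z1 z2 < 3 * dl.
Proof.
move=> [z1' [[B1 B1'] d1 <-]] [z2' [[B2 B2'] d2 [eq1 eq2]]].
have d12 : sup_dist z1' z2' < dl.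
  by apply/sup_dist_lt; split; rewrite Rabs_minus_sym; apply: pixel_coord_eq_close.
have := sup_dist_triangle z1 z1' z2; have := sup_dist_triangle z1' z2' z2.
by rewrite (sup_distC z2' z2); lra.
Qed.

Variables (f : nat -> R * R) (n : nat).
Hypothesis f_square : forall i, (i <= n)%N -> in_square (f i).
Hypothesis f_step : forall i, (i < n)%N -> sup_dist (f i) (f i.+1) < dl.

(* Updating the two coordinates alternately makes the pixel path 4-connected. *)
Definition staircase (l : nat) : nat * nat := pixel_of ((f (uphalf l)).1, (f l./2).2).

Lemma staircase_near l : (l < n.*2)%N -> near (staircase l) (staircase l.+1).
Proof.
move=> ln; have ln2 : (l./2 < n)%N by lia.
have [/sup_dist_lt[dx dy] [xB yB] [xB' yB']] :=
  And3 (f_step ln2) (f_square (ltnW ln2)) (f_square ln2).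
rewrite /near /staircase /pixel_of /=; case: (boolP (odd l)) => ol; [left | right].
  have -> : uphalf l = l./2.+1 by lia.
  by split=> //; split; apply: pixel_coord_close; rewrite // Rabs_minus_sym.
have -> : uphalf l = l./2 by lia.
by split=> //; split; apply: pixel_coord_close; rewrite // Rabs_minus_sym.
Qed.

Lemma staircase_shadow l : (l <= n.*2)%N -> shadow (f l./2) (staircase l).
Proof.
move=> ln; exists ((f (uphalf l)).1, (f l./2).2); split=> //.
  have [xB _] := f_square (i := uphalf l) ltac:(lia).
  by have [_ yB] := f_square (i := l./2) ltac:(lia).
apply/sup_dist_lt; rewrite /= Rminus_diag Rabs_R0; split=> //.
case: (boolP (odd l)) => ol.
  have -> : uphalf l = l./2.+1 by lia.
  by have /sup_dist_lt[] := f_step (i := l./2) ltac:(lia).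
by rewrite (_ : uphalf l = l./2) ?Rminus_diag ?Rabs_R0 //; lia.
Qed.

End Pixelation.

Section SampleTimes.
Local Open Scope R_scope.
Variable m : nat.
Hypothesis m_gt0 : (0 < m)%N.

Definition sample_time (i : nat) : R := INR i / INR (3 * m).

Lemma sample_time_mul c : sample_time (c * m) = INR c / 3.
Proof.
have INRm : INR m <> 0 by apply: not_0_INR; lia.
rewrite /sample_time /Rdiv !mult_INR Rinv_mult (_ : INR 3 = 3); last by rewrite /=; lra.
by rewrite Rmult_assoc (Rmult_comm (/ 3)) -(Rmult_assoc (INR m)) Rinv_r // Rmult_1_l.
Qed.

Lemma sample_time_le i j : (i <= j)%N -> sample_time i <= sample_time j.
Proof.
move=> ij; apply: Rmult_le_compat_r; last by apply: le_INR; lia.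
by apply/Rlt_le/Rinv_0_lt_compat/lt_0_INR; lia.
Qed.

Lemma sample_time0 : sample_time 0 = 0.
Proof. by rewrite -(mul0n m) sample_time_mul /=; lra. Qed.

Lemma sample_time1 : sample_time (3 * m) = 1.
Proof. by rewrite sample_time_mul /=; lra. Qed.

Lemma sample_timeS i : sample_time i.+1 - sample_time i = / INR (3 * m).
Proof. by rewrite /sample_time S_INR; lra. Qed.

Lemma sample_time_unit i : (i <= 3 * m)%N -> unitI (sample_time i).
Proof.
by move=> i3m; split; [rewrite -sample_time0 | rewrite -sample_time1]; apply: sample_time_le.
Qed.

End SampleTimes.

Section PlaneDrawing.
Local Open Scope R_scope.
Variables (V Ed : finType) (ends : Ed -> V * V).

Record plane_drawing (pos : V -> R * R) (arc : Ed -> R -> R * R) : Prop := PlaneDrawing {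
  pos_inj : injective pos;
  arc_continuous : forall e, continuous_curve (arc e);
  arc_first : forall e, arc e 0 = pos (ends e).1;
  arc_last : forall e, arc e 1 = pos (ends e).2;
  arc_neq_pos : forall e t v, openI t -> arc e t <> pos v;
  arc_inj : forall e e' s t, openI s -> openI t -> arc e s = arc e' t -> e = e' /\ s = t
}.

Lemma planar_plane_drawing : planar_graph ends -> exists pos arc, plane_drawing pos arc.
Proof.
move=> [px [py [gx [gy [p_inj [cont [g_ends [g_inj [g_avoid g_disj]]]]]]]]].
exists (fun v => (px v, py v)), (fun e t => (gx e t, gy e t)).
split=> [u v [px_uv py_uv]|e|e|e|e t v ot [gx_t gy_t]|e e' s t os ot [gx_st gy_st]].
- exact: p_inj.
- exact: continuous_curve_pair (cont e).
- by have [-> [-> _]] := g_ends e.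
- by have [_ [_ [-> ->]]] := g_ends e.
- exact: (g_avoid e t v ot).
have ee' : e = e'.
  by apply: boolp.contrapT => neq; apply: (g_disj e e' s t neq os ot).
split=> //; rewrite -{e'}ee' in gx_st gy_st; apply: boolp.contrapT => neq.
have unit_open r : openI r -> unitI r by move=> [? ?]; split; lra.
have [us ut] := (unit_open s os, unit_open t ot); case: os ot => [s0 _] [t0 _].
have [st|ts] : s < t \/ t < s by lra.
  by have [] := g_inj e s t us ut st gx_st gy_st; lra.
by have [] := g_inj e t s ut us ts (esym gx_st) (esym gy_st); lra.
Qed.

Variables (pos : V -> R * R) (arc : Ed -> R -> R * R).
Hypothesis drawing : plane_drawing pos arc.
Implicit Types (u v : V) (e : Ed) (z : R * R).

Definition owns (o : V + Ed) z : Prop :=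
  match o with
  | inl u => z = pos u \/ exists e t, [/\ openI t, arc e t = z &
      t <= 1 / 3 /\ (ends e).1 = u \/ 2 / 3 <= t /\ (ends e).2 = u]
  | inr e => exists t, 1 / 3 <= t <= 2 / 3 /\ arc e t = z
  end.

Lemma owns_vertices u v z : owns (inl u) z -> owns (inl v) z -> u = v.
Proof.
move=> [->|[e [t [ot <- own_u]]]] [zE|[e' [t' [ot' zE own_v]]]].
- exact: pos_inj drawing _ _ zE.
- by case: (arc_neq_pos drawing ot' zE).
- by case: (arc_neq_pos drawing ot zE).
have [ee' tt'] := arc_inj drawing ot' ot zE; rewrite {}ee' {}tt' in own_v.
by case: own_u own_v => [[ht <-]|[ht <-]] [[ht' <-]|[ht' <-]] //; exfalso; lra.
Qed.

Lemma owns_edges e e' z : owns (inr e) z -> owns (inr e') z -> e = e'.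
Proof.
move=> [t [ht <-]] [t' [ht' zE]].
have [ot ot'] : openI t /\ openI t' by split; split; lra.
by have [] := arc_inj drawing ot' ot zE.
Qed.

Lemma owns_vertex_edge u e z : owns (inl u) z -> owns (inr e) z ->
  (u == (ends e).1) || (u == (ends e).2).
Proof.
move=> own_u [t [ht zE]]; have ot : openI t by split; lra.
case: own_u => [z_u|[e' [t' [ot' z_e' own_u]]]].
  by case: (arc_neq_pos drawing ot (etrans zE z_u)).
have [<- _] : e' = e /\ t' = t by apply: (arc_inj drawing) => //; rewrite z_e'.
by case: own_u => [[_ ->]|[_ ->]]; rewrite eqxx ?orbT.
Qed.

Lemma owns_touching o o' z : owns o z -> owns o' z -> touching ends o o'.
Proof.
case: o o' => [u|e] [v|e'] own own' /=.
- by rewrite (owns_vertices own own').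
- exact: owns_vertex_edge own own'.
- exact: owns_vertex_edge own' own.
- by rewrite (owns_edges own own').
Qed.

(* A piece is a vertex, or the first (Some false), middle (None) or last (Some true)
   third of an arc. *)
Local Notation piece := (V + Ed * option bool)%type.
Implicit Types j : piece.

Definition piece_curve j (t : R) : R * R :=
  match j with inl v => pos v | inr (e, _) => arc e t end.
Definition piece_start j : R :=
  match j with inr (_, None) => 1 / 3 | inr (_, Some true) => 2 / 3 | _ => 0 end.
Definition piece_stop j : R :=
  match j with inr (_, None) => 2 / 3 | inr (_, Some false) => 1 / 3 | _ => 1 end.
Definition piece_owner j : V + Ed :=
  match j with
  | inl v => inl v
  | inr (e, None) => inr e
  | inr (e, Some false) => inl (ends e).1
  | inr (e, Some true) => inl (ends e).2
  end.

Lemma owns_piece j t : piece_start j <= t <= piece_stop j ->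
  owns (piece_owner j) (piece_curve j t).
Proof.
case: j => [v|[e [[|]|]]] /= ht; [by left | | | by exists t].
- have [->|neq] := boolp.pselect (t = 1); first by left; exact: arc_last.
  by right; exists e, t; split=> //; [split; lra | right; split=> //; lra].
- have [->|neq] := boolp.pselect (t = 0); first by left; exact: arc_first.
  by right; exists e, t; split=> //; [split; lra | left; split=> //; lra].
Qed.

Definition separated eps j j' : Prop :=
  ~~ touching ends (piece_owner j) (piece_owner j') -> forall s t,
  piece_start j <= s <= piece_stop j -> piece_start j' <= t <= piece_stop j' ->
  eps <= sup_dist (piece_curve j s) (piece_curve j' t).

Lemma pieces_separated : exists eps, 0 < eps /\ forall j j', separated eps j j'.
Proof.
have curve_cont j : continuous_curve (piece_curve j).
  by case: j => [v|[e third]]; [exact: continuous_curve_const | exact: (arc_continuous drawing e)].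
have start_ge0 j : 0 <= piece_start j by case: j => [v|[e [[|]|]]] /=; lra.
have stop_le1 j : piece_stop j <= 1 by case: j => [v|[e [[|]|]]] /=; lra.
have [jj eps eps' far [_ le_eps] not_touch s t hs ht|[j j']|eps [eps0 epsP]] :=
  @fin_common_pos (piece * piece)%type (fun jj eps => separated eps jj.1 jj.2).
- exact: Rle_trans le_eps (far not_touch s t hs ht).
- case: (boolP (touching ends (piece_owner j) (piece_owner j'))) => [touch|not_touch].
    by exists 1; split; [lra | rewrite /separated touch].
  have [|eps [eps0 epsP]] := disjoint_arcs_dist (curve_cont j) (curve_cont j')
    (start_ge0 j) (stop_le1 j) (start_ge0 j') (stop_le1 j').
    move=> s t hs ht st; have own := owns_piece ht; rewrite -st in own.
    by have := owns_touching (owns_piece hs) own; rewrite (negbTE not_touch).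
  by exists eps; split=> // _.
by exists eps; split=> // j j'; exact: (epsP (j, j')).
Qed.

Lemma fine_samples dl : 0 < dl -> exists2 m, (0 < m)%N & forall e i, (i < 3 * m)%N ->
  sup_dist (arc e (sample_time m i)) (arc e (sample_time m i.+1)) < dl.
Proof.
move=> dl0.
have [e d d' close [_ d'd] x y ux uy xy|e|d [d0 close]] := @fin_common_pos Ed (fun e d =>
  forall x y, unitI x -> unitI y -> Rabs (x - y) < d -> sup_dist (arc e x) (arc e y) < dl).
- by apply: close => //; lra.
- exact: continuous_curve_uniform (arc_continuous drawing e) dl0.
have [m [md m_gt0]] := archimed_cor1 d d0; move/ssrnat.ltP: m_gt0 => m_gt0.
exists m => // e i i3m; apply: close; [apply: sample_time_unit; lia.. |].
have INRm : INR m <= INR (3 * m) by apply: le_INR; lia.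
have INRm0 : 0 < INR m by apply: lt_0_INR; lia.
have := Rinv_le_contravar _ _ INRm0 INRm.
have : 0 < / INR (3 * m) by apply: Rinv_0_lt_compat; lra.
by have := sample_timeS m i; split_Rabs; lra.
Qed.

Section Sampled.
Variables (dl B : R) (m : nat).
Hypothesis dl0 : 0 < dl.
Hypothesis m_gt0 : (0 < m)%N.
Local Notation sample e := (fun i => arc e (sample_time m i)).
Hypothesis pos_square : forall v, in_square B (pos v).
Hypothesis sample_square : forall e i, (i <= 3 * m)%N -> in_square B (sample e i).
Hypothesis sample_close : forall e i, (i < 3 * m)%N -> sup_dist (sample e i) (sample e i.+1) < dl.
Hypothesis far_pieces : forall j j', separated (3 * dl) j j'.

Local Notation base := (fun v => pixel_of B dl (pos v)).
Local Notation path := (fun e => staircase B dl (sample e)).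
Local Notation occupies := (occupies ends m.*2 (4 * m) (3 * m).*2 base path).

Lemma occupies_shadow o p : occupies o p -> exists j t,
  [/\ piece_owner j = o, piece_start j <= t <= piece_stop j & shadow B dl (piece_curve j t) p].
Proof.
have before c l : (l./2 <= c * m)%N -> sample_time m l./2 <= INR c / 3.
  by move=> lc; rewrite -(sample_time_mul m_gt0); exact: sample_time_le.
have after c l : (c * m <= l./2)%N -> INR c / 3 <= sample_time m l./2.
  by move=> lc; rewrite -(sample_time_mul m_gt0); exact: sample_time_le.
have path_shadow e l : (l <= (3 * m).*2)%N -> shadow B dl (sample e l./2) (path e l).
  exact: (staircase_shadow dl0 (@sample_square e) (@sample_close e)).
case: o => [u [<-|[e [l [<- [[la eu]|[lb eu]]]]]]|e [l [<- lab]]].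
- exists (inl u), 0; split=> //=; first lra.
  exact: (shadow_pixel_of dl0 (pos_square u)).
- exists (inr (e, Some false)), (sample_time m l./2); split; first by rewrite /= eu.
    have [lt0 _] := sample_time_unit m_gt0 (i := l./2) ltac:(lia).
    by have := before 1%N l ltac:(lia); rewrite /=; lra.
  by apply: path_shadow; lia.
- exists (inr (e, Some true)), (sample_time m l./2); split; first by rewrite /= eu.
    have [_ lt1] := sample_time_unit m_gt0 (i := l./2) ltac:(lia).
    by have := after 2%N l ltac:(lia); rewrite /=; lra.
  by apply: path_shadow; lia.
exists (inr (e, None)), (sample_time m l./2); split=> //; last by apply: path_shadow; lia.
by have := after 1%N l ltac:(lia); have := before 2%N l ltac:(lia); rewrite /=; lra.
Qed.

Lemma sampled_pixel_drawing : pixel_drawing ends m.*2 (4 * m) (3 * m).*2 base path.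
Proof.
split=> [|e|e|e l lL|o o' p].
- by lia.
- by rewrite /staircase /= (sample_time0 m_gt0) (arc_first drawing).
- by rewrite /staircase uphalf_double doubleK (sample_time1 m_gt0) (arc_last drawing).
- exact: (staircase_near dl0 (@sample_square e) (@sample_close e) lL).
move=> /occupies_shadow[j [s [<- hs shadow_s]]] /occupies_shadow[j' [t [<- ht shadow_t]]].
apply/negPn/negP => not_touch; have := far_pieces not_touch hs ht.
by have := shadow_close dl0 shadow_s shadow_t; lra.
Qed.

End Sampled.

Lemma plane_drawing_pixel_drawing : exists a b L base path, pixel_drawing ends a b L base path.
Proof.
have [eps [eps0 far]] := pieces_separated; have dl0 : 0 < eps / 3 by lra.
have [m m_gt0 close] := fine_samples dl0.
have [B [_ BP]] := @fin_bounded ((V + Ed * 'I_(3 * m).+1) * bool)%type (fun jb =>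
  let z := match jb.1 with inl v => pos v | inr (e, i) => arc e (sample_time m i) end in
  if jb.2 then z.1 else z.2).
exists m.*2, (4 * m)%N, (3 * m).*2, (fun v => pixel_of B (eps / 3) (pos v)),
  (fun e => staircase B (eps / 3) (fun i => arc e (sample_time m i))).
apply: sampled_pixel_drawing => // [v|e i i3m|j j'].
- by split; [exact: (BP (inl v, true)) | exact: (BP (inl v, false))].
- have := BP (inr (e, inord i), true); have := BP (inr (e, inord i), false).
  by rewrite /= inordK.
by rewrite (_ : 3 * (eps / 3) = eps); [exact: far | lra].
Qed.

End PlaneDrawing.

Theorem planar_grid_minor (V Ed : finType) (ends : Ed -> V * V) : planar_graph ends ->
  exists N lab, minor_model ends (@grid_ends N N) lab.
Proof.
move=> /planar_plane_drawing[pos [arc /plane_drawing_pixel_drawing]].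
by move=> [a [b [L [base [path]]]]]; exact: pixel_drawing_minor.
Qed.

Theorem mainTheorem1
  (n m d : nat)
  (rel1 : 'I_n -> 'I_n -> 'I_d.+1) (rel2 : 'I_m -> 'I_m -> 'I_d.+1)
  (E1 : 'I_d.+1 -> 'M[Cplx]_n) (E2 : 'I_d.+1 -> 'M[Cplx]_m) :
  is_sym_assoc_scheme rel1 -> is_sym_assoc_scheme rel2 ->
  is_prim_idempotents rel1 E1 -> is_prim_idempotents rel2 E2 ->
  exactly_triply_regular Cplx rel1 -> exactly_triply_regular Cplx rel2 ->
  (exists sigma, is_DeltaWye rel1 E1 sigma /\ is_DeltaWye rel2 E2 sigma) ->
  forall kappa : 'M[Cplx]_n -> 'M[Cplx]_m,
  (forall c : 'I_d.+1 -> Cplx,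
     kappa (\sum_i c i *: adjmx Cplx rel1 i) = \sum_i c i *: adjmx Cplx rel2 i) ->
  forall (V Ed : finType) (ends : Ed -> V * V),
  connected_graph ends -> planar_graph ends ->
  forall w : Ed -> 'M[Cplx]_n, (forall e, inBM rel1 (w e)) ->
  scaffold0 ends w = scaffold0 ends (fun e => kappa (w e)).
Proof.
move=> scheme1 scheme2 prim1 prim2 etr1 etr2 [sigma [dw1 dw2]] kappa kappaE V Ed ends _ planar.
move=> w w_bm.
have [nm [t [Et1 Et2]]] := same_trivial_idempotent scheme1 scheme2 prim1 prim2 dw1 dw2.
subst m; have [c wE] := fin_all_exists w_bm.
have [N [lab lab_minor]] := planar_grid_minor planar.
rewrite (eq_scaffold0 _ (w' := fun e => bmx rel1 (c e)) wE).
rewrite (eq_scaffold0 _ (w := fun e => kappa (w e)) (w' := fun e => bmx rel2 (c e))).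
  apply: (minor_scaffold_eq scheme1 scheme2 lab_minor) => host_c.
  exact: (grid_scaffold_eq host_c scheme1 scheme2 prim1 prim2 etr1 etr2 dw1 dw2 Et1 Et2).
by move=> e; rewrite wE kappaE.
Qed.
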